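(* Let $p,q,r,s$ be distinct primes such that $p \equiv q \equiv 3 \pmod 4$ and $r \equiv s \equiv 3 \pmod 4$. Then $\mathbb{Q}(\sqrt{p}, \sqrt{qrs})$ is a Pólya field in the following cases. (i) $\left(\frac{2}{r}\right) \neq \left(\frac{2}{s}\right)$, $\left(\frac{q}{r}\right) = \left(\frac{q}{s}\right) = \left(\frac{p}{q}\right) = 1$, and $\left(\frac{p}{r}\right) = \left(\frac{p}{s}\right) = -1$. (ii) $\left(\frac{2}{r}\right) = \left(\frac{2}{s}\right) \neq \left(\frac{2}{q}\right)$, $\left(\frac{q}{r}\right) = \left(\frac{r}{s}\right) = \left(\frac{s}{q}\right)$, and $\left(\frac{pr}{s}\right) = \left(\frac{ps}{r}\right) = -1$.
   Context: Here $\left(\frac{a}{\ell}\right)$ is the Legendre symbol for an odd prime $\ell$. For a number field $K$ with ring of integers $\mathcal{O}_K$, a prime number $\ell$ and an integer $f\ge 1$, the Ostrowski ideal $\Pi_{\ell^f}(K)$ is the product of all maximal ideals $\mathfrak{m}$ of $\mathcal{O}_K$ with norm $N_{K/\mathbb{Q}}(\mathfrak{m}) = \ell^f$ (equal to $\mathcal{O}_K$ if there are none). The Pólya group $Po(K)$ is the subgroup of the ideal class group of $K$ generated by the classes of all Ostrowski ideals of $K$. $K$ is a Pólya field if all its Ostrowski ideals are principal, equivalently if $Po(K)$ is trivial. *)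

(* Defs.v *)
From HB Require Import structures.
From mathcomp Require Import all_boot all_order all_algebra all_field.
From mathcomp Require Import finmap.
From mathcomp Require Import mathcomp_extra boolp classical_sets functions.
From mathcomp Require Import cardinality fsbigop.

Set Implicit Arguments.
Unset Strict Implicit.
Unset Printing Implicit Defensive.

Import Order.TTheory GRing.Theory Num.Theory.
Local Open Scope classical_set_scope.
Local Open Scope ring_scope.

(* Meaningful when l is an odd prime. *)
Definition legendre (a : int) (l : nat) : int :=
  if (l%:Z %| a)%Z then 0
  else if [exists x : 'I_l, (((x : nat)%:Z ^+ 2)%R == a %[mod l%:Z])%Z] then 1
  else -1.

Section NumberField.

Variable K : fieldExtType rat.

Implicit Types (I J m : set K) (l f : nat).

Definition ringOfIntegers : set K :=
  [set x | integralOver (intr : int -> K) x].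

Local Notation OK := ringOfIntegers.

(* Ideals of the ring of integers are represented as subsets of K. *)
Definition is_ideal I : Prop :=
  [/\ I `<=` OK, I 0, (forall x y, I x -> I y -> I (x + y))
    & (forall a x, OK a -> I x -> I (a * x))].

Definition is_maximal_ideal m : Prop :=
  [/\ is_ideal m, m <> OK
    & forall J, is_ideal J -> m `<=` J -> J = m \/ J = OK].

Definition is_principal I : Prop :=
  exists2 a, OK a & I = [set a * x | x in OK].

Definition ideal_mul I J : set K :=
  [set z | exists n (x y : 'I_n -> K),
     [/\ (forall i, I (x i)), (forall i, J (y i)) & z = \sum_(i < n) x i * y i]].

(* The number of cosets of I in the ring of integers; since fset_set is empty
   on infinite sets, the value is 0 when the quotient is infinite (I = 0). *)
Definition ideal_norm I : nat :=
  #|` fset_set [set [set a + x | x in I] | a in OK]|.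

(* The index set is finite, so the product over it is a genuine one; the
   neutral element gives the value of the empty product. *)
Definition ostrowski_ideal l f : set K :=
  \big[ideal_mul/OK]_(m \in [set m | is_maximal_ideal m
                                     /\ ideal_norm m = (l ^ f)%N]) m.

Definition is_polya_field : Prop :=
  forall l f, prime l -> (0 < f)%N -> is_principal (ostrowski_ideal l f).

End NumberField.

(* Main.v *)
Require Import Defs.
From mathcomp Require Import all_boot all_order all_algebra all_field.
From mathcomp Require Import all_fingroup all_solvable.
From mathcomp Require Import finmap.
From mathcomp Require Import boolp classical_sets functions.
From mathcomp Require Import cardinality fsbigop.
From mathcomp Require Import zify ring lra.
Set Implicit Arguments.
Unset Strict Implicit.
Unset Printing Implicit Defensive.
Import Order.TTheory GRing.Theory Num.Theory.
Local Open Scope ring_scope.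

(** Write D = qrs and K = Q(a, b) with a^2 = p and b^2 = D. The primes that
ramify in K are 2, p, q, r, s, all with index 2, so that the product of the
primes above such an l has square l O_K, while for any other l it is l O_K.
Hence K is a Polya field as soon as each of 2, p, q, r, s is a unit of O_K
times the square of an element of K. For p this element is a, and the
positive integers of this kind are stable under quotients
([unit_square_div]).

The other squares come from units. Let N be odd and not a square, with a root
w in K, and let x^2 - N y^2 = 1 be the smallest nontrivial solution of Pell's
equation. Splitting (x - 1)(x + 1) = N y^2 into coprime parts gives
d2 v^2 - d1 u^2 = c with d1 d2 = N and c = 1 or 2, where d2 = 1 is impossible
for c = 1 by minimality ([pell_split]). Then (d2 v + w u)^2 is c d2 times a
unit ([unit_square_pell]), so that c d2 is of the wanted kind. Reducing the
equation modulo the prime factors of N, which are 3 mod 4, turns it into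
conditions on quadratic residues ([pell_relation]) that leave few choices of
d2. N = p yields 2. N = pq leaves exactly one choice, and this is the
quadratic reciprocity law for primes that are 3 mod 4 ([nonres_recip]).
N = pqrs yields q, or rs, up to the known factor p, because the hypotheses on
the symbols exclude all other divisors ([symbols_relation4]). N = qrs then
yields r or s up to q ([symbols_relation3]), and the relation from b gives
the last prime.

On the side of ideals, distinct maximal ideals are comaximal, so that the
Ostrowski ideal is the intersection J of the maximal ideals of norm l^f
([prod_maximal]). If there are any, then J is an ideal stable under the Galois
group, and its integers are the multiples of l. Let alpha^2 = l u with u a
unit, or alpha = l if l does not ramify: alpha lies in J because maximal
ideals are prime, and J = alpha O_K once every x in J is divisible by alpha
([ostrowski_principal]). For odd l this follows from the traces of x, xa, xb
and xab, which are integers of J and thus multiples of l: up to a factor prime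
to l they are the coordinates of x ([trace_lattice]). For l = 2 the factor 4
in these traces is in the way, and an explicit integral basis is used instead:
modulo alpha one has a = 1, so that O_K / alpha is generated by
(1 + ab) / 2, on which the trace argument works again ([ramified2_div]). *)

(** * The Pell equation *)

Lemma isqrt_ex n : exists k, (k ^ 2 <= n < k.+1 ^ 2)%N.
Proof.
elim: n => [|n [k /andP[le_kn lt_nk]]]; first by exists 0%N.
have [lt_nk'|le_kn'] := ltnP n.+1 (k.+1 ^ 2).
  by exists k; rewrite lt_nk' (leq_trans le_kn).
by exists k.+1; rewrite le_kn' /=; nia.
Qed.

(** The sum of u <= c t and g <= a t, where t is the square root of D; the squared form
stays within the natural numbers. *)
Lemma sqr_le_add (D u c g a : nat) : (u ^ 2 <= D * c ^ 2)%N ->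
  (g ^ 2 <= D * a ^ 2)%N -> ((u + g) ^ 2 <= D * (c + a) ^ 2)%N.
Proof.
move=> leu leg; have : (u * g <= D * (c * a))%N.
  by rewrite -leq_sqr; have := leq_mul leu leg; nia.
nia.
Qed.

Lemma sqr_gt_add (D u c g a : nat) : (D * c ^ 2 <= u ^ 2)%N ->
  (D * a ^ 2 < g ^ 2)%N -> (D * (c + a) ^ 2 < (u + g) ^ 2)%N.
Proof.
move=> leu leg; have : (D * (c * a) <= u * g)%N.
  rewrite -leq_sqr; have := leq_mul leu (ltnW leg); nia.
nia.
Qed.

Definition nonsquare D := forall k, (k ^ 2)%N != D.

Lemma nonsquare_mul D x y : nonsquare D -> (0 < y)%N ->
  (x ^ 2 != D * y ^ 2)%N.
Proof.
move=> nsD y_gt0; apply/eqP => xDy.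
have /dvdnP[k xk] : (y %| x)%N by rewrite -(@dvdn_pexp2r _ _ 2) // xDy dvdn_mull.
have /eqP[] := nsD k.
by apply/eqP; rewrite -(@eqn_pmul2r (y ^ 2)%N) ?expn_gt0 ?y_gt0 // -expnMn -xk xDy.
Qed.

(** Dirichlet's approximation of the square root of D: two of the N + 1 multiples of
it by 0, ..., N have fractional parts in the same interval of length 1/N. The
bound N <= 2 X, which follows because the norm is a nonzero integer, forces new
solutions as N grows. *)
Lemma pell_approx (D N : nat) : nonsquare D -> (0 < N)%N ->
  exists X Y : nat, [/\ (0 < Y)%N, (N <= 2 * X)%N,
    (X ^ 2 <= D * Y ^ 2 + 2 * D)%N & (D * Y ^ 2 <= X ^ 2 + 2 * D)%N].
Proof.
move=> nsD N_gt0.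
have sqN y : exists k, (k ^ 2 <= D * (N * y) ^ 2 < k.+1 ^ 2)%N by apply: isqrt_ex.
pose f y := xchoose (sqN y).
have fP y : (f y ^ 2 <= D * (N * y) ^ 2)%N /\ (D * (N * y) ^ 2 < (f y).+1 ^ 2)%N.
  by apply/andP; exact: (xchooseP (sqN y)).
(* f y is the integer part of N y t, with t the square root of D, so that f y mod N
   locates the fractional part of y t among N intervals. *)
pose bin (y : 'I_N.+1) := Ordinal (ltn_pmod (f y) N_gt0).
have : ~~ injectiveb bin.
  by apply/negP => /injectiveP/leq_card; rewrite !card_ord ltnn.
case/injectivePn => y1 [y2 neq12 /(congr1 val) /= bin12].
wlog lt12 : y1 y2 neq12 bin12 / (y1 < y2)%N.
  case: (ltngtP y1 y2) => [lt12|lt21|/val_inj eq12] ih; first exact: (ih y1 y2).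
    by apply: (ih y2 y1) => //; rewrite eq_sym.
  by rewrite eq12 eqxx in neq12.
have [le1 gt1] := fP y1; have [le2 gt2] := fP y2.
set F1 := f y1 in le1 gt1 bin12; set F2 := f y2 in le2 gt2 bin12.
pose Y := (y2 - y1)%N; have Y_gt0 : (0 < Y)%N by rewrite subn_gt0.
have y2E : (N * y2 = N * Y + N * y1)%N by rewrite -mulnDr subnK // ltnW.
have leF : (F1 <= F2)%N.
  rewrite -ltnS -ltn_sqr; apply: leq_ltn_trans le1 (leq_ltn_trans _ gt2).
  by rewrite leq_mul2l leq_sqr leq_mul2l (ltnW lt12) !orbT.
have [X FE] : exists X, (F2 = F1 + N * X)%N.
  exists ((F2 - F1) %/ N)%N.
  by rewrite mulnC divnK ?subnKC // -eqn_mod_dvd // bin12.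
(* |N X - N Y t| < 1 *)
have up : (D * (N * Y) ^ 2 < (N * X + 1) ^ 2)%N.
  rewrite ltnNge; apply/negP => leY.
  have := sqr_le_add leY le1; rewrite -y2E leqNgt => /negP[].
  by have -> : (N * X + 1 + F1 = F2.+1)%N by rewrite FE addn1 addSn addnC.
have low : ((N * X - 1) ^ 2 <= D * (N * Y) ^ 2)%N.
  case: (posnP (N * X)) => [->|NX_gt0] //; rewrite leqNgt; apply/negP => ltY.
  have := sqr_gt_add (ltnW ltY) gt1; rewrite -y2E ltnNge => /negP[].
  by have -> : (N * X - 1 + F1.+1 = F2)%N by rewrite FE addnS -addSn subn1 prednK // addnC.
clear bin12 bin.
have leX : (N * X <= D * N ^ 2)%N.
  apply: (@leq_trans F2); first by rewrite FE leq_addl.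
  rewrite -leq_sqr; apply: leq_trans le2 _.
  have le_y2 : (y2 <= N)%N by rewrite -ltnS ltn_ord.
  have D_gt0 : (0 < D)%N by rewrite lt0n; have := nsD 0%N; rewrite eq_sym.
  apply: (@leq_trans (D * (N * N) ^ 2)).
    by rewrite leq_mul2l leq_sqr leq_mul2l le_y2 !orbT.
  by rewrite [leqRHS]expnMn mulnn leq_mul2r -[(D ^ 2)%N]mulnn leq_pmulr ?orbT.
have neqXY := nonsquare_mul X nsD Y_gt0.
have {}low : ((N * X) ^ 2 <= D * (N * Y) ^ 2 + 2 * (N * X))%N.
  by move: low; move: (D * _)%N (N * X)%N => u v; clear; case: v => [|v]; lia.
have {}up : (D * (N * Y) ^ 2 <= (N * X) ^ 2 + 2 * (N * X))%N.
  by move: up; move: (D * _)%N (N * X)%N => u v; clear; lia.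
have N2_gt0 : (0 < N ^ 2)%N by rewrite expn_gt0 N_gt0.
rewrite !expnMn (mulnCA D) in low up.
clear -low up leX neqXY N_gt0 N2_gt0 Y_gt0.
exists X, Y; split => //.
- rewrite -(leq_pmul2l N_gt0) mulnn.
  move: low up neqXY; move: (X ^ 2)%N (D * Y ^ 2)%N => u v low up neq.
  case: (ltngtP u v) neq => // lt _.
    have : (N ^ 2 * u.+1 <= N ^ 2 * v)%N by rewrite leq_pmul2l.
    rewrite mulnS => le_uv; have := leq_trans le_uv up.
    by rewrite addnC leq_add2l mulnCA.
  have : (N ^ 2 * v.+1 <= N ^ 2 * u)%N by rewrite leq_pmul2l.
  rewrite mulnS => le_vu; have := leq_trans le_vu low.
  by rewrite addnC leq_add2l mulnCA.
- rewrite -(leq_pmul2l N2_gt0) mulnDr (mulnCA _ 2 D) (mulnC _ D).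
  by apply: (leq_trans low); rewrite leq_add2l leq_pmul2l.
- rewrite -(leq_pmul2l N2_gt0) mulnDr (mulnCA _ 2 D) (mulnC _ D).
  by apply: (leq_trans up); rewrite leq_add2l leq_pmul2l.
Qed.

Lemma pell_approx_seq (D n : nat) : nonsquare D ->
  exists s : seq (nat * nat), [/\ uniq s, size s = n &
    forall z, z \in s -> [/\ (0 < z.2)%N, (z.1 ^ 2 <= D * z.2 ^ 2 + 2 * D)%N
                          & (D * z.2 ^ 2 <= z.1 ^ 2 + 2 * D)%N]].
Proof.
move=> nsD; suff [s [B [us ss sP _]]] : exists (s : seq (nat * nat)) B,
    [/\ uniq s, size s = n, forall z, z \in s ->
      [/\ (0 < z.2)%N, (z.1 ^ 2 <= D * z.2 ^ 2 + 2 * D)%N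
        & (D * z.2 ^ 2 <= z.1 ^ 2 + 2 * D)%N]
      & forall z, z \in s -> (z.1 < B)%N] by exists s.
elim: n => [|n [s [B [us ss sP sB]]]]; first by exists [::], 0%N.
have [X [Y [Y_gt0 leX le1 le2]]] := pell_approx nsD (ltn0Sn (2 * B)).
have ltBX : (B < X)%N by lia.
exists ((X, Y) :: s), X.+1; split => /=.
- by rewrite us andbT; apply/negP => /sB /=; rewrite ltnNge (ltnW ltBX).
- by rewrite ss.
- by move=> z; rewrite inE => /orP[/eqP->|/sP].
- by move=> z; rewrite inE => /orP[/eqP-> //|/sB/ltn_trans->] //; apply: ltnW.
Qed.

(** Infinitely many pairs have norm at most 2 D in absolute value. Two distinct ones
with the same norm k that agree modulo k have a quotient with integer
coordinates and norm 1. *)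
Lemma pell_exists (D : nat) : nonsquare D ->
  exists x y : nat, (0 < y)%N /\ (x ^ 2 = D * y ^ 2 + 1)%N.
Proof.
(* m is a multiple of every norm that can occur. *)
move=> nsD; pose m := (2 * D)`!.
have m_gt0 : (0 < m)%N by apply: fact_gt0.
pose res n : 'I_m := Ordinal (ltn_pmod n m_gt0).
pose col (z : nat * nat) : 'I_(4 * D).+1 * 'I_m * 'I_m :=
  (inord (z.1 ^ 2 + 2 * D - D * z.2 ^ 2), res z.1, res z.2).
have [s [us ss sP]] :=
  pell_approx_seq #|{: 'I_(4 * D).+1 * 'I_m * 'I_m}|.+1 nsD.
have : ~~ uniq (map col s).
  apply/negP => /card_uniqP cs; have := max_card (mem (map col s)).
  by rewrite cs size_map ss ltnn.
case/(uniqPn (col (0, 0)%N)) => i [j [lt_ij lt_j]].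
rewrite size_map in lt_j; have lt_i := ltn_trans lt_ij lt_j.
rewrite !(nth_map (0, 0)%N) //.
set z := nth _ s i; set w := nth _ s j.
have neq_zw : z != w by rewrite nth_uniq ?(ltn_eqF lt_ij).
have [z2 zl zr] := sP z (mem_nth _ lt_i).
have [w2 wl wr] := sP w (mem_nth _ lt_j).
case: z neq_zw z2 zl zr => X1 Y1 neq /= Y1_gt0 l1 r1.
case: w neq w2 wl wr => X2 Y2 neq /= Y2_gt0 l2 r2.
rewrite /col /= => -[/(congr1 (@nat_of_ord _)) eq_k eqX eqY].
rewrite !inordK in eq_k; [|lia|lia].
pose k : int := X1%:Z ^+ 2 - D%:Z * Y1%:Z ^+ 2.
have k1 : X1%:Z ^+ 2 = k + D%:Z * Y1%:Z ^+ 2 by rewrite /k subrK.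
have k2 : X2%:Z ^+ 2 = k + D%:Z * Y2%:Z ^+ 2.
  by move: eq_k; rewrite /k; clear -l1 r1 l2 r2; lia.
have k_neq0 : k != 0.
  apply: contra (nonsquare_mul X1 nsD Y1_gt0); rewrite /k; clear; lia.
have k_dvd : (k %| m%:Z)%Z.
  rewrite dvdzE dvdn_fact //; apply/andP; split; first by rewrite absz_gt0.
  by rewrite /k; clear -l1 r1; lia.
clearbody k.
have dvd_sub (x y : nat) : x = y %[mod m] -> exists t : int, x%:Z = y%:Z + t * k.
  move=> xy; have : (m%:Z %| x%:Z - y%:Z)%Z by rewrite -eqz_mod_dvd !modz_nat xy.
  by move/(dvdz_trans k_dvd)/dvdzP => [t tk]; exists t; rewrite -tk addrC subrK.
have [t tX] := dvd_sub _ _ eqX; have [u uY] := dvd_sub _ _ eqY.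
(* (X1 - Y1 t) (X2 + Y2 t) = k (P + Q t), with t the square root of D *)
pose P := t * X2%:Z - D%:Z * u * Y2%:Z + 1.
pose Q := t * Y2%:Z - u * X2%:Z.
have PE : k * P = X1%:Z * X2%:Z - D%:Z * Y1%:Z * Y2%:Z.
  rewrite /P tX uY.
  transitivity (X2%:Z ^+ 2 - D%:Z * Y2%:Z ^+ 2 + t * k * X2%:Z - D%:Z * u * k * Y2%:Z); last by ring.
  by rewrite k2; ring.
have QE : k * Q = X1%:Z * Y2%:Z - Y1%:Z * X2%:Z by rewrite /Q tX uY; ring.
have PQ : P ^+ 2 = D%:Z * Q ^+ 2 + 1.
  apply: (mulfI (expf_neq0 2 k_neq0)).
  transitivity ((k * P) ^+ 2); first by ring.
  transitivity (D%:Z * (k * Q) ^+ 2 + k ^+ 2); last by ring.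
  rewrite PE QE.
  have -> : k ^+ 2 = (X1%:Z ^+ 2 - D%:Z * Y1%:Z ^+ 2) * (X2%:Z ^+ 2 - D%:Z * Y2%:Z ^+ 2).
    by rewrite k1 k2; ring.
  by ring.
exists `|P|%N, `|Q|%N; split; last by move: PQ; clear; lia.
rewrite absz_gt0; apply: contra neq => /eqP Q0; rewrite Q0 mulr0 in QE.
have eqXY : X1%:Z * Y2%:Z = Y1%:Z * X2%:Z by apply/eqP; rewrite -subr_eq0 -QE.
have : k * (Y1%:Z ^+ 2 - Y2%:Z ^+ 2) = 0.
  have -> : k * (Y1%:Z ^+ 2 - Y2%:Z ^+ 2) =
     (k + D%:Z * Y2%:Z ^+ 2) * Y1%:Z ^+ 2 - (k + D%:Z * Y1%:Z ^+ 2) * Y2%:Z ^+ 2 by ring.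
  rewrite -k1 -k2; transitivity ((Y1%:Z * X2%:Z) ^+ 2 - (X1%:Z * Y2%:Z) ^+ 2); first by ring.
  by rewrite eqXY subrr.
move/eqP; rewrite mulf_eq0 (negbTE k_neq0) subr_eq0 /= eqrXn2 ?lez_nat // => /eqP[eqYY].
rewrite eqYY [X in _ = X]mulrC in eqXY.
have Y2_neq0 : Y2%:Z != 0 by rewrite eqz_nat -lt0n.
by have [->] := mulIf Y2_neq0 eqXY; rewrite eqYY.
Qed.

Lemma gcdn_sqr m n : gcdn (m ^ 2) (n ^ 2) = (gcdn m n ^ 2)%N.
Proof.
have [g0|g_gt0] := posnP (gcdn m n).
  have := gcdn_gt0 m n; rewrite g0 => /esym/norP[].
  by rewrite -!leqNgt !leqn0 => /eqP-> /eqP->.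
have co : coprime (m %/ gcdn m n) (n %/ gcdn m n).
  by rewrite /coprime -(eqn_pmul2r g_gt0) muln_gcdl !divnK ?dvdn_gcdl ?dvdn_gcdr ?mul1n.
rewrite -[X in gcdn (X ^ 2)](divnK (dvdn_gcdl m n)).
rewrite -[X in gcdn _ (X ^ 2)](divnK (dvdn_gcdr m n)).
rewrite !expnMn -muln_gcdl.
have /eqP-> : coprime ((m %/ gcdn m n) ^ 2) ((n %/ gcdn m n) ^ 2) by rewrite coprimeXl ?coprimeXr.
by rewrite mul1n.
Qed.

Lemma coprime_mul_sqr a b y : coprime a b -> (a * b = y ^ 2)%N ->
  exists u v, a = (u ^ 2)%N /\ b = (v ^ 2)%N.
Proof.
have sqr a' b' : coprime a' b' -> (a' * b' = y ^ 2)%N -> a' = (gcdn a' y ^ 2)%N.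
  by move=> /eqP co ab; rewrite -gcdn_sqr -ab -mulnn -muln_gcdr co muln1.
move=> co ab; exists (gcdn a y), (gcdn b y); split; first exact: sqr ab.
by apply: (sqr b a); [rewrite coprime_sym | rewrite mulnC].
Qed.

(** By coprimality gcd(D, a) gcd(D, b) = gcd(D, a b) = D, and the cofactors of a and b
are coprime with product y^2. *)
Lemma coprime_mul_split D a b y : coprime a b -> (a * b = D * y ^ 2)%N -> (0 < D)%N ->
  exists d1 d2 u v, [/\ (d1 * d2 = D)%N, a = (d1 * u ^ 2)%N & b = (d2 * v ^ 2)%N].
Proof.
move=> co ab D_gt0; pose d1 := gcdn D a; pose d2 := gcdn D b.
have d12 : (d1 * d2 = D)%N.
  apply/eqP; rewrite eqn_dvd; apply/andP; split.
    rewrite Gauss_dvd ?dvdn_gcdl // /d1 /d2.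
    by apply: coprime_dvdl (dvdn_gcdr _ _) (coprime_dvdr (dvdn_gcdr _ _) co).
  rewrite /d1 /d2 muln_gcdl !muln_gcdr ab !dvdn_gcd.
  by rewrite dvdn_mulr // dvdn_mulr // dvdn_mull // dvdn_mulr.
have [a' aE] : exists a', a = (d1 * a')%N.
  by exists (a %/ d1)%N; rewrite mulnC divnK ?dvdn_gcdr.
have [b' bE] : exists b', b = (d2 * b')%N.
  by exists (b %/ d2)%N; rewrite mulnC divnK ?dvdn_gcdr.
have ab' : (a' * b' = y ^ 2)%N.
  by apply/eqP; rewrite -(eqn_pmul2l D_gt0) -ab aE bE -{1}d12 mulnACA.
have co' : coprime a' b'.
  by move: co; rewrite aE bE coprimeMl !coprimeMr => /andP[_ /andP[_ ->]].
have [u [v [uE vE]]] := coprime_mul_sqr co' ab'.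
by exists d1, d2, u, v; rewrite aE bE -uE -vE.
Qed.

(** A solution of x^2 - D y^2 = 1 makes (x - 1)(x + 1) split as in
[coprime_mul_split], after division by 4 when x is odd. The odd case gives c = 1,
and d2 = 1 would then be a smaller solution. *)
Lemma pell_split D : odd D -> nonsquare D -> exists c d1 d2 u v,
  [/\ (c == 1)%N || (c == 2)%N, (d1 * d2 = D)%N, (d2 * v ^ 2 = d1 * u ^ 2 + c)%N
    & (c == 1)%N ==> (d2 != 1)%N].
Proof.
move=> oD nsD; have D_gt0 := odd_gt0 oD.
have ex : exists y, (0 < y)%N && [exists x : 'I_(D * y ^ 2 + 2), (x ^ 2 == D * y ^ 2 + 1)%N].
  have [x [y [y_gt0 xy]]] := pell_exists nsD; exists y; rewrite y_gt0 /=.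
  have ltx : (x < D * y ^ 2 + 2)%N by nia.
  by apply/existsP; exists (Ordinal ltx); rewrite /= xy.
case: (ex_minnP ex) => y /andP[y_gt0 /existsP[[x ltx] /= /eqP xy]] miny {ex ltx}.
have {}miny u v : (0 < u)%N -> (v ^ 2 = D * u ^ 2 + 1)%N -> (y <= u)%N.
  move=> u_gt0 uv; apply: miny; rewrite u_gt0 /=.
  have ltv : (v < D * u ^ 2 + 2)%N by nia.
  by apply/existsP; exists (Ordinal ltv); rewrite /= uv.
have Dy_gt0 : (0 < D * y ^ 2)%N by rewrite muln_gt0 D_gt0 expn_gt0 y_gt0.
have x_gt1 : (1 < x)%N by nia.
have [xx | [w xE]] : (coprime (x - 1) (x + 1)) \/ exists w, x = (2 * w + 1)%N.
  have := odd_double_half x; case ox: (odd x) => /= xE.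
    by right; exists x./2; rewrite -muln2 in xE; lia.
  left; have -> : (x + 1 = 2 + (x - 1))%N by lia.
  by rewrite /coprime gcdnDr -/(coprime _ _) coprimen2 oddB ?(ltnW x_gt1) ?ox.
- have [|d1 [d2 [u [v [d12 uE vE]]]]] := coprime_mul_split xx (y := y) _ D_gt0.
    have -> : (D * y ^ 2 = x ^ 2 - 1)%N by lia.
    by rewrite -[in RHS](exp1n 2) subn_sqr.
  by exists 2%N, d1, d2, u, v; split=> //; rewrite -uE -vE; lia.
have [y' yE] : exists y', y = (2 * y')%N.
  have oy : ~~ odd y.
    have : odd (D * y ^ 2 + 1) by rewrite -xy xE oddX addn1 /= oddM.
    by rewrite oddD oddM oddX oD /= addbT.
  by exists y./2; rewrite mul2n -[LHS]odd_double_half (negbTE oy).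
have cow : coprime w (w + 1).
  by rewrite addn1 coprimenS.
have [|d1 [d2 [u [v [d12 uE vE]]]]] := coprime_mul_split cow (y := y') _ D_gt0.
  by rewrite xE yE in xy; lia.
exists 1%N, d1, d2, u, v; split=> //; first by rewrite -uE -vE.
apply/implyP => _; apply/eqP => d2E.
have d1E : d1 = D by rewrite -d12 d2E muln1.
rewrite d2E mul1n in vE; rewrite d1E in uE.
have u_gt0 : (0 < u)%N.
  by rewrite lt0n; apply: contraTneq x_gt1 => u0; rewrite xE uE u0 muln0.
have : (y <= u)%N by apply: miny (v) _ _ => //; rewrite -vE -uE.
have v_gt0 : (0 < v)%N by move: vE; case: v => //; rewrite addn1.
have -> : y = (2 * (u * v))%N.
  rewrite yE; congr (2 * _)%N; apply/eqP; rewrite -eqn_sqr -(eqn_pmul2l D_gt0).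
  by rewrite expnMn mulnA -uE -vE; apply/eqP; rewrite xE yE in xy; lia.
by clear -u_gt0 v_gt0; nia.
Qed.

(** * Quadratic residues *)

(** The additive form of the Legendre symbol of n, for n prime to l. *)
Definition nonres (l n : nat) : bool := ~~ [exists x : 'F_l, x ^+ 2 == n%:R].

Lemma finField_prim_root (F : finFieldType) :
  exists g : F, forall x, x != 0 -> exists k, x = g ^+ k.
Proof.
have /cyclicP[g gE] := field_unit_group_cyclic [set: {unit F}]%G.
exists (val g) => x x_neq0.
have x_unit : x \is a GRing.unit by rewrite unitfE.
have : FinRing.unit F x_unit \in <[g]>%g by rewrite -gE inE.
by case/cycleP => k /(congr1 val) /= ->; exists k; rewrite FinRing.val_unitX.
Qed.

Lemma natr_Fp_eq0 l n : prime l -> (n%:R == 0 :> 'F_l) = (l %| n)%N.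
Proof. by move=> pl; rewrite -(dvdn_pcharf (pchar_Fp pl)). Qed.

Lemma sqr_mul_sqr (F : finFieldType) (y z : F) : z != 0 ->
  [exists x : F, x ^+ 2 == y * z ^+ 2] = [exists x : F, x ^+ 2 == y].
Proof.
move=> z_neq0; apply/existsP/existsP => -[x /eqP xE].
  by exists (x / z); rewrite expr_div_n xE mulfK ?expf_neq0.
by exists (x * z); rewrite exprMn xE.
Qed.

(** The product of two nonsquares is a square because both are odd powers of a
generator of the multiplicative group. *)
Lemma nonsqrM (F : finFieldType) (x y : F) : x != 0 -> y != 0 ->
  ~~ [exists z : F, z ^+ 2 == x * y] =
  ~~ [exists z : F, z ^+ 2 == x] (+) ~~ [exists z : F, z ^+ 2 == y].
Proof.
move=> x0 y0.
case: (boolP [exists z : F, z ^+ 2 == y]) => [/existsP[z /eqP zE]|ny].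
  by move: y0; rewrite -zE expf_eq0 /= => z0; rewrite sqr_mul_sqr ?addbF.
case: (boolP [exists z : F, z ^+ 2 == x]) => [/existsP[z /eqP zE]|nx].
  by move: x0; rewrite -zE expf_eq0 /= => z0; rewrite mulrC sqr_mul_sqr ?ny.
apply/negbTE; rewrite negbK; have [g gP] := finField_prim_root F.
have odd_exp (z : F) : z != 0 -> ~~ [exists t : F, t ^+ 2 == z] ->
    exists k, z = g * (g ^+ k) ^+ 2.
  move=> /gP[k ->] nz; exists k./2.
  rewrite -{1}[k]odd_double_half -muln2 exprD exprM.
  case: (boolP (odd k)) => [|ok]; first by rewrite expr1.
  case/negP: nz; apply/existsP; exists (g ^+ k./2).
  by rewrite -exprM muln2 -{2}[k]odd_double_half (negbTE ok).
have [j ->] := odd_exp x x0 nx; have [k ->] := odd_exp y y0 ny.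
by apply/existsP; exists (g * g ^+ j * g ^+ k); apply/eqP; ring.
Qed.

Lemma nonresM l m n : prime l -> ~~ (l %| m)%N -> ~~ (l %| n)%N ->
  nonres l (m * n) = nonres l m (+) nonres l n.
Proof. by move=> pl; rewrite -!natr_Fp_eq0 // /nonres natrM; apply: nonsqrM. Qed.

Lemma nonres_sqr l v : nonres l (v ^ 2) = false.
Proof. by apply/negbTE; rewrite negbK; apply/existsP; exists v%:R; rewrite -natrX. Qed.

Lemma nonres1 l : nonres l 1 = false.
Proof. exact: (nonres_sqr l 1). Qed.

Lemma nonres_congr l m n : m%:R = n%:R :> 'F_l -> nonres l m = nonres l n.
Proof. by rewrite /nonres => ->. Qed.

(** The half of l - 1 is odd, so that x^2 = -1 would give x^(l - 1) = -1. *)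
Lemma nonresN1 l : prime l -> l = 3 %[mod 4] -> ~~ [exists x : 'F_l, x ^+ 2 == -1].
Proof.
move=> pl l3; apply/existsP => -[x /eqP xE].
have x0 : x != 0 by apply: contraTneq isT => x0; move: xE; rewrite x0 expr0n => /eqP;
   rewrite eq_sym oppr_eq0 oner_eq0.
have l_eq : (l.-1 = 2 * (2 * (l %/ 4)).+1)%N by rewrite {1}(divn_eq l 4) l3; lia.
have : x ^+ l.-1 = 1.
  apply: (mulfI x0); rewrite -exprS prednK ?prime_gt0 // mulr1.
  by have := expf_card x; rewrite card_Fp.
rewrite l_eq exprM xE exprS exprM sqrrN !expr1n mulr1 => /eqP.
rewrite eq_sym -addr_eq0 -(natrD _ 1 1) natr_Fp_eq0 // dvdn_prime2 // => /eqP le2.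
by rewrite le2 in l3.
Qed.

(** * Pell relations modulo their prime divisors *)

Section PellLocal.
Variables (l c d1 d2 u v : nat).
Hypotheses (pl : prime l) (l3 : l = 3 %[mod 4]) (lc : ~~ (l %| c)%N).
Hypothesis E : (d2 * v ^ 2 = d1 * u ^ 2 + c)%N.

Lemma nonres_left : (l %| d1)%N -> ~~ (l %| d2)%N -> nonres l d2 = nonres l c.
Proof.
move=> ld1 ld2.
have E' : ((d2 * v ^ 2)%:R = c%:R :> 'F_l).
  by apply/eqP; rewrite E natrD -subr_eq0 addrK natr_Fp_eq0 // dvdn_mulr.
have lv : ~~ (l %| v ^ 2)%N.
  by apply: contra lc => lv; rewrite -natr_Fp_eq0 // -E' natr_Fp_eq0 // dvdn_mull.
by rewrite -(nonres_congr E') nonresM // nonres_sqr addbF.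
Qed.

Lemma nonres_right : (l %| d2)%N -> ~~ (l %| d1)%N -> nonres l d1 = ~~ nonres l c.
Proof.
move=> ld2 ld1.
have [k kE] : exists k, l = k.+1 by exists l.-1; rewrite prednK ?prime_gt0.
have Nk : k%:R = -1 :> 'F_l.
  by apply/eqP; rewrite -addr_eq0 -(natrD _ k 1) addn1 -kE natr_Fp_eq0 // dvdnn.
have lk : ~~ (l %| k)%N by rewrite -natr_Fp_eq0 // Nk oppr_eq0 oner_eq0.
have nk : nonres l k by rewrite /nonres Nk nonresN1.
have E' : ((d1 * u ^ 2)%:R = (k * c)%:R :> 'F_l).
  have -> : (k * c)%:R = - c%:R :> 'F_l by rewrite natrM Nk mulN1r.
  by apply/eqP; rewrite -addr_eq0 -natrD -E natr_Fp_eq0 // dvdn_mulr.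
have lu : ~~ (l %| u ^ 2)%N.
  have : ~~ (l %| k * c)%N by rewrite Euclid_dvdM // negb_or lk lc.
  by apply: contra => lu; rewrite -natr_Fp_eq0 // -E' natr_Fp_eq0 // dvdn_mull.
have := nonres_congr E'; rewrite nonresM // nonres_sqr addbF => ->.
by rewrite nonresM // nk addTb.
Qed.
End PellLocal.

Lemma legendreE (l n : nat) : prime l -> ~~ (l %| n)%N ->
  legendre n l = (-1) ^+ nonres l n.
Proof.
move=> pl ln; rewrite /legendre dvdzE /= (negbTE ln) /nonres.
suff -> : [exists x : 'I_l, (((x : nat)%:Z ^+ 2)%R == n %[mod l%:Z])%Z] =
    [exists x : 'F_l, x ^+ 2 == n%:R].
  by case: [exists x, _].
have sqE (x : nat) : ((x%:Z ^+ 2)%R == n %[mod l%:Z])%Z = ((x%:R : 'F_l) ^+ 2 == n%:R).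
  rewrite -natrX expr2 -PoszM mulnn !modz_nat eqz_nat.
  by rewrite -(inj_eq val_inj) /= !val_Fp_nat.
apply/existsP/existsP => -[x xE].
  by exists (x : nat)%:R; rewrite -sqE.
have lx : (x < l)%N by rewrite -{2}(Fp_cast pl).
exists (Ordinal lx); rewrite sqE /=.
by rewrite natr_Zp.
Qed.

Definition primes3mod4 (ps : seq nat) :=
  uniq ps && all (fun p => prime p && (p %% 4 == 3)%N) ps.

Section Squarefree.
Variable ps : seq nat.
Hypotheses (ups : uniq ps) (pps : all prime ps).

Lemma dvdn_prod_primes (e : pred nat) l : l \in ps ->
  (l %| \prod_(m <- ps | e m) m)%N = e l.
Proof.
move=> ls; have pl := allP pps l ls.
rewrite Euclid_dvd_prod // big_has_cond; apply/hasP/idP => [[m ms /andP[em]]|el].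
  by rewrite dvdn_prime2 ?(allP pps) // => /eqP->.
by exists l; rewrite /= ?el ?dvdnn.
Qed.
End Squarefree.

Lemma nonres_prod l (s : seq nat) (e : pred nat) : prime l ->
  (forall m, m \in s -> e m -> ~~ (l %| m)%N) ->
  nonres l (\prod_(m <- s | e m) m)%N = \big[addb/false]_(m <- s | e m) nonres l m.
Proof.
move=> pl; elim: s => [|x s ih] lP; first by rewrite !big_nil nonres1.
have {}ih := ih (fun m ms => lP m (mem_behead (s := x :: s) ms)).
rewrite !big_cons; case: ifP => // ex; rewrite -ih nonresM //.
  by apply: lP => //; rewrite mem_head.
rewrite Euclid_dvd_prod // big_has_cond; apply/hasPn => m ms.
rewrite negb_and; case: (boolP (e m)) => //= em.
by apply: lP; rewrite ?inE ?ms ?orbT.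
Qed.

(** Factorizations of a product of distinct primes are encoded by predicates, which
turns residue symbols of the factors into sums over the primes. *)
Lemma factor_prod_primes ps d1 d2 : uniq ps -> all prime ps ->
  (d1 * d2 = \prod_(m <- ps) m)%N ->
  exists e : pred nat, d1 = (\prod_(m <- ps | ~~ e m) m)%N /\
                       d2 = (\prod_(m <- ps | e m) m)%N.
Proof.
elim: ps d1 d2 => [|x s ih] d1 d2 /=.
  rewrite big_nil => _ _ /eqP; rewrite muln_eq1 => /andP[/eqP-> /eqP->].
  by exists xpred0; rewrite !big_nil.
case/andP=> xs us /andP[px ps]; rewrite big_cons => E.
have x_gt0 := prime_gt0 px.
have bigE (P Q : pred nat) : {in s, P =1 Q} ->
    (\prod_(m <- s | P m) m = \prod_(m <- s | Q m) m)%N.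
  move=> PQ; rewrite big_seq_cond [RHS]big_seq_cond; apply: eq_bigl => m.
  by case: (boolP (m \in s)) => //= /PQ.
have xd : (x %| d1 * d2)%N by rewrite E dvdn_mulr.
move: xd; rewrite Euclid_dvdM // => /orP[] /dvdnP[k kE].
  have [|e [e1 e2]] := ih k d2 us ps.
    by apply/eqP; rewrite -(eqn_pmul2l x_gt0) -E kE mulnA (mulnC x).
  exists (fun m => (m != x) && e m); rewrite !big_cons /= eqxx /=; split.
    rewrite kE e1 mulnC; congr (_ * _)%N; apply: bigE => m ms.
    by have -> : m != x by apply: contraNneq xs => <-.
  rewrite e2; apply: bigE => m ms.
  by have -> : m != x by apply: contraNneq xs => <-.
have [|e [e1 e2]] := ih d1 k us ps.
  by apply/eqP; rewrite -(eqn_pmul2l x_gt0) -E kE mulnC mulnA.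
exists (fun m => (m == x) || e m); rewrite !big_cons /= eqxx /=; split.
  rewrite e1; apply: bigE => m ms.
  by have -> : m == x = false by apply/negbTE; apply: contraNneq xs => <-.
rewrite kE e2 mulnC; congr (_ * _)%N; apply: bigE => m ms.
by have -> : m == x = false by apply/negbTE; apply: contraNneq xs => <-.
Qed.

Lemma nonsquare_prod_primes ps : uniq ps -> all prime ps -> ps != [::] ->
  nonsquare (\prod_(m <- ps) m)%N.
Proof.
case: ps => // x s /= /andP[xs us] /andP[px ps] _ k; rewrite big_cons.
apply: contra xs => /eqP kE.
have : (x %| k)%N by have := Euclid_dvdX k 2 px; rewrite kE dvdn_mulr ?andbT.
case/dvdnP => j jE; move: kE; rewrite jE mulnC expnMn -mulnn -mulnA => /eqP.
rewrite eqn_pmul2l ?prime_gt0 // => /eqP E.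
have : (x %| \prod_(m <- s) m)%N by rewrite -E dvdn_mulr.
rewrite Euclid_dvd_prod // big_has => /hasP[m ms].
by rewrite dvdn_prime2 ?(allP ps m) // => /eqP->.
Qed.

(** The arithmetic content of the smallest Pell solution for a product of primes that
are 3 mod 4. Modulo a prime of d1 the relation d2 v^2 = d1 u^2 + c makes c d2 a
square, and modulo a prime of d2 it makes - c d1 a square. *)
Lemma pell_relation ps : primes3mod4 ps -> ps != [::] -> exists c u v (e : pred nat),
  [/\ (c == 1)%N || (c == 2)%N,
      ((\prod_(m <- ps | e m) m) * v ^ 2 =
       (\prod_(m <- ps | ~~ e m) m) * u ^ 2 + c)%N,
      (c == 1)%N ==> has e ps &
      forall l, l \in ps ->
        if e l then \big[addb/false]_(m <- ps | ~~ e m) nonres l m = ~~ nonres l c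
        else \big[addb/false]_(m <- ps | e m) nonres l m = nonres l c].
Proof.
case/andP=> ups p3 ps0.
have pps : all prime ps by apply: sub_all p3 => p /andP[].
have oddp p : p \in ps -> odd p.
  move=> /(allP p3)/andP[_ /eqP p4].
  by rewrite (divn_eq p 4) p4 oddD oddM andbF.
have oddD : odd (\prod_(m <- ps) m)%N.
  by rewrite big_seq; elim/big_ind: _ => // x y ox oy; rewrite oddM ox oy.
have [c [d1 [d2 [u [v [c12 d12 E c1]]]]]] :=
  pell_split oddD (nonsquare_prod_primes ups pps ps0).
have [e [d1E d2E]] := factor_prod_primes ups pps d12.
exists c, u, v, e; rewrite -d1E -d2E; split=> //.
  apply/implyP => cE; have := implyP c1 cE; apply: contraR => /hasPn ne.
  rewrite d2E big_seq_cond big1 // => m /andP[ms]; by rewrite (negbTE (ne _ ms)).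
move=> l ls; have /andP[pl /eqP l4] := allP p3 l ls.
have lc : ~~ (l %| c)%N.
  apply/negP => /(dvdn_leq _) lc; have := oddp l ls; have := prime_gt1 pl.
  have : (l <= 2)%N.
    by case/orP: c12 lc => /eqP-> lc; [apply: leq_trans (lc isT) _ | apply: lc].
  by move=> l2 l1; have -> : l = 2%N by lia.
have lm m : m \in ps -> m != l -> ~~ (l %| m)%N.
  by move=> ms; rewrite dvdn_prime2 ?(allP pps) // eq_sym.
have ld1 : (l %| d1)%N = ~~ e l by rewrite d1E dvdn_prod_primes.
have ld2 : (l %| d2)%N = e l by rewrite d2E dvdn_prod_primes.
case: ifP => el.
  rewrite -nonres_prod //; last by move=> m ms em; apply: lm => //; apply: contraNneq em => ->.
  by rewrite -d1E; apply: (nonres_right pl _ lc E); rewrite ?ld1 ?ld2 ?el.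
rewrite -nonres_prod //; last first.
  by move=> m ms em; apply: lm => //; apply: contraTneq em => ->; rewrite el.
by rewrite -d2E; apply: (nonres_left pl lc E); rewrite ?ld1 ?ld2 ?el.
Qed.

(** For d1 d2 = 1 mod 4 multiplication by d2 reduces the equation to
v^2 = u^2 + 2 mod 4. This rules out c = 2 in Pell relations. *)
Lemma sqr_mod4_diff d1 d2 u v : (d1 * d2 = 1 %[mod 4] ->
  d2 * v ^ 2 <> d1 * u ^ 2 + 2)%N.
Proof.
move=> d12 /(congr1 (modn^~ 4%N)); move: d12.
rewrite -!mulnn -(modnMm d1 d2) -(modnMm d2 (v * v)) -(modnMm v v).
rewrite -(modnDml (d1 * (u * u))) -(modnMm d1 (u * u)) -(modnMm u u).
have := ltn_pmod d1 (isT : 0 < 4)%N; have := ltn_pmod d2 (isT : 0 < 4)%N.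
have := ltn_pmod u (isT : 0 < 4)%N; have := ltn_pmod v (isT : 0 < 4)%N.
move: (d1 %% 4)%N (d2 %% 4)%N (u %% 4)%N (v %% 4)%N.
by do 4![case=> [|[|[|[|?]]]] //].
Qed.

(** Quadratic reciprocity for primes that are 3 mod 4. In a Pell relation for p q the
nontrivial factorizations are p v^2 = q u^2 + 1 and q v^2 = p u^2 + 1, and each of
them determines both symbols; -1 being a nonresidue excludes d2 = p q. *)
Lemma nonres_recip p q : prime p -> prime q -> p != q ->
  p = 3 %[mod 4] -> q = 3 %[mod 4] -> nonres q p = ~~ nonres p q.
Proof.
move=> pp pq npq p4 q4.
have : primes3mod4 [:: p; q] by rewrite /primes3mod4 /= !inE npq pp pq p4 q4.
case/pell_relation => // c [u [v [e [c12 E c1 rel]]]].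
have cE : c = 1%N.
  case/orP: c12 => /eqP // c2; move: E; rewrite c2 => /sqr_mod4_diff[].
  have -> : (\prod_(m <- [:: p; q] | ~~ e m) m * \prod_(m <- [:: p; q] | e m) m = p * q)%N.
    by rewrite !big_cons !big_nil; case: (e p); case: (e q); rewrite /= ?muln1 ?mul1n // mulnC.
  by rewrite -modnMm p4 q4.
have := rel p (mem_head _ _); have := rel q; rewrite !inE eqxx orbT => /(_ isT).
move: c1 {E}; rewrite cE /= !nonres1 !big_cons !big_nil /=.
by case: (e p); case: (e q) => //=; rewrite ?addbF; do 2!case: (nonres _ _).
Qed.

(** * The symbols of the four primes *)

Section Arith.
Variables (p q r s : nat).
Hypotheses (p_prime : prime p) (q_prime : prime q)
    (r_prime : prime r) (s_prime : prime s)
    (pqrs_distinct : uniq [:: p; q; r; s])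
    (p_mod4 : p = 3 %[mod 4]) (q_mod4 : q = 3 %[mod 4])
    (r_mod4 : r = 3 %[mod 4]) (s_mod4 : s = 3 %[mod 4]).

Definition symbols1 : bool :=
  [&& nonres r 2 != nonres s 2, ~~ nonres r q, ~~ nonres s q, ~~ nonres q p,
      nonres r p & nonres s p].

(** By multiplicativity (pr/s) = (ps/r) = -1 says that (p/s) differs from (r/s) and (p/r)
from (s/r). *)
Definition symbols2 : bool :=
  [&& nonres r 2 == nonres s 2, nonres s 2 != nonres q 2,
      nonres r q == nonres s r, nonres s r == nonres q s,
      nonres s p != nonres s r & nonres r p != nonres r s].

Let p34 : primes3mod4 [:: p; q; r; s].
Proof.
rewrite /primes3mod4 pqrs_distinct /= p_prime q_prime r_prime s_prime.
by rewrite p_mod4 q_mod4 r_mod4 s_mod4.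
Qed.

Let distinct : [/\ p != q, p != r, p != s, q != r & q != s /\ r != s].
Proof.
move: pqrs_distinct; rewrite /= !inE !negb_or -!andbA.
by case/and5P => -> -> -> -> /and3P[-> -> _].
Qed.

Lemma symbols_of_legendre :
  ([/\ legendre 2 r <> legendre 2 s,
       legendre q r = 1, legendre q s = 1, legendre p q = 1
     & legendre p r = -1 /\ legendre p s = -1] -> symbols1) /\
  ([/\ legendre 2 r = legendre 2 s, legendre 2 s <> legendre 2 q,
       legendre q r = legendre r s, legendre r s = legendre s q
     & legendre (p * r)%N s = -1 /\ legendre (p * s)%N r = -1] -> symbols2).
Proof.
have [pq pr ps qr [qs rs]] := distinct.
have nd l m : prime l -> prime m -> l != m -> ~~ (l %| m)%N.
  by move=> pl pm; rewrite dvdn_prime2.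
have n2 l : prime l -> l = 3 %[mod 4] -> ~~ (l %| 2)%N.
  by move=> pl l4; rewrite dvdn_prime2 //; apply: contra_eqN l4 => /eqP->.
have sgnE (b1 b2 : bool) : ((-1) ^+ b1 == (-1) ^+ b2 :> int) = (b1 == b2).
  by case: b1; case: b2.
have sgn1 (b : bool) : ((-1) ^+ b == 1 :> int) = ~~ b by case: b.
have sgnN1 (b : bool) : ((-1) ^+ b == -1 :> int) = b by case: b.
have l2 l : prime l -> l = 3 %[mod 4] -> legendre 2 l = (-1) ^+ nonres l 2.
  by move=> pl l4; apply: (legendreE pl (n2 l pl l4)).
have sp : s != p by rewrite eq_sym.
have rp : r != p by rewrite eq_sym.
have rq : r != q by rewrite eq_sym.
have sq : s != q by rewrite eq_sym.
have sr : s != r by rewrite eq_sym.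
have qp : q != p by rewrite eq_sym.
rewrite !l2 // !legendreE ?nonresM ?Euclid_dvdM ?negb_or ?nd //.
rewrite /symbols1 /symbols2; split.
  case=> /eqP + /eqP + /eqP + /eqP + [/eqP + /eqP +].
  by rewrite !sgnE !sgn1 !sgnN1 => -> -> -> -> -> ->.
case=> /eqP + /eqP + /eqP + /eqP + [/eqP + /eqP +].
rewrite !sgnE !sgnN1 => -> -> -> ->.
by case: (nonres s p); case: (nonres s r); case: (nonres r p); case: (nonres r s).
Qed.

(** By reciprocity one symbol per pair of primes remains. Going through the
factorizations of q r s, those with r and s on the same side contradict the
hypotheses on the symbols; for c = 2 this uses the symbols of 2. *)
Lemma symbols_relation3 (c : nat) (e : pred nat) : symbols1 || symbols2 ->
  (c == 1)%N || (c == 2)%N -> (c == 1)%N ==> has e [:: q; r; s] ->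
  (forall l, l \in [:: q; r; s] ->
        if e l then \big[addb/false]_(m <- [:: q; r; s] | ~~ e m) nonres l m = ~~ nonres l c
        else \big[addb/false]_(m <- [:: q; r; s] | e m) nonres l m = nonres l c) ->
  e r != e s.
Proof.
have [pq pr ps qr [qs rs]] := distinct.
move=> sym c12 c1 rel; move: sym c1.
have := rel q; have := rel r; have := rel s; rewrite !inE !eqxx !orbT.
move=> /(_ isT) + /(_ isT) + /(_ isT).
rewrite /symbols1 /symbols2 !big_cons !big_nil /=.
rewrite (nonres_recip q_prime r_prime) // (nonres_recip q_prime s_prime) //.
rewrite (nonres_recip r_prime s_prime) //.
move: (nonres q r) (nonres q s) (nonres r s) (nonres q p) (nonres r p) (nonres s p).
case/orP: c12 => /eqP -> /=; rewrite ?nonres1;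
  move: (nonres q 2) (nonres r 2) (nonres s 2);
  case: (e q); case: (e r); case: (e s) => //; by do 9!case.
Qed.

(** Among the factorizations of p q r s only those that separate q from both r and s
are compatible with the symbols. *)
Lemma symbols_relation4 (e : pred nat) : symbols1 || symbols2 ->
  has e [:: p; q; r; s] ->
  (forall l, l \in [:: p; q; r; s] ->
        if e l then \big[addb/false]_(m <- [:: p; q; r; s] | ~~ e m) nonres l m = ~~ nonres l 1
        else \big[addb/false]_(m <- [:: p; q; r; s] | e m) nonres l m = nonres l 1) ->
  e r = e s /\ e q != e r.
Proof.
have [pq pr ps qr [qs rs]] := distinct.
move=> sym e1 rel.
(* For c = 1 the equations do not involve the symbols of 2. *)
have {}sym : [&& ~~ nonres r q, ~~ nonres s q, ~~ nonres q p, nonres r p & nonres s p]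
  || [&& nonres r q == nonres s r, nonres s r == nonres q s,
         nonres s p != nonres s r & nonres r p != nonres r s].
  by case/orP: sym => [/andP[_ ->] // | /and3P[_ _ ->]]; rewrite orbT.
move: sym e1; have := rel p; have := rel q; have := rel r; have := rel s; rewrite !inE !eqxx !orbT.
move=> /(_ isT) + /(_ isT) + /(_ isT) + /(_ isT).
rewrite !big_cons !big_nil /= !nonres1.
rewrite (nonres_recip p_prime q_prime) // (nonres_recip p_prime r_prime) //.
rewrite (nonres_recip p_prime s_prime) //.
rewrite (nonres_recip q_prime r_prime) // (nonres_recip q_prime s_prime) //.
rewrite (nonres_recip r_prime s_prime) //.
move: (nonres p q) (nonres p r) (nonres p s) (nonres q r) (nonres q s) (nonres r s).
case: (e q); case: (e r); case: (e s); case: (e p) => //; by do 6!case.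
Qed.

(** S n stands for: n is a unit of O_K times the square of an element of K. *)
Section Generation.
Variable S : nat -> Prop.
Hypothesis S_div : forall m n, (0 < m)%N -> S m -> S (m * n)%N -> S n.
Hypothesis S_p : S p.
Hypothesis S_qrs : S (q * r * s)%N.
Hypothesis S_pell : forall c d1 d2 u v,
  [\/ (d1 * d2 = p)%N, (d1 * d2 = q * r * s)%N | (d1 * d2 = p * (q * r * s))%N] ->
  (c == 1)%N || (c == 2)%N -> (d2 * v ^ 2 = d1 * u ^ 2 + c)%N -> S (c * d2)%N.

(** In a Pell relation for p itself c = 1 is impossible: d2 = 1 is excluded by
minimality and d2 = p by -1 being a nonresidue. For c = 2 it gives S 2 or S (2 p). *)
Lemma class_2 : S 2.
Proof.
have p1 : primes3mod4 [:: p] by rewrite /primes3mod4 /= p_prime p_mod4.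
have [//|c [u [v [e [c12 E c1 rel]]]]] := pell_relation p1 _.
have := rel p; rewrite inE eqxx => /(_ isT).
move: E c1 (@S_pell c (\prod_(m <- [:: p] | ~~ e m) m) (\prod_(m <- [:: p] | e m) m) u v).
rewrite !big_cons !big_nil /= orbF; case: (e p) => /= E c1 SE.
  case/orP: c12 E c1 SE => /eqP-> E _ SE; first by rewrite nonres1.
  move=> _; apply: (S_div (prime_gt0 p_prime)) => //; rewrite mulnC -[X in (_ * X)%N]muln1.
  by apply: SE => //; constructor 1; rewrite muln1 mul1n.
case/orP: c12 E c1 SE => /eqP-> // E _ SE _.
by rewrite -[2%N]muln1; apply: SE => //; constructor 1; rewrite !muln1.
Qed.

Lemma prod_compl (e : pred nat) (ps : seq nat) :
  ((\prod_(m <- ps | ~~ e m) m) * (\prod_(m <- ps | e m) m) = \prod_(m <- ps) m)%N.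
Proof. by rewrite mulnC [RHS](bigID e). Qed.

(** The relation for p q r s gives q, the one for q r s gives r or s, and S (q r s)
then gives the remaining prime. *)
Lemma class_2qrs : symbols1 || symbols2 -> [/\ S 2, S q, S r & S s].
Proof.
move=> sym; have S2 := class_2.
have [p0 q0 r0 s0] : [/\ 0 < p, 0 < q, 0 < r & 0 < s]%N.
  by rewrite !prime_gt0.
have Sq : S q.
  have [//|c [u [v [e [c12 E c1 rel]]]]] := pell_relation p34 _.
  have prodE : ((\prod_(m <- [:: p; q; r; s] | ~~ e m) m) *
      (\prod_(m <- [:: p; q; r; s] | e m) m) = p * (q * r * s))%N.
    by rewrite prod_compl !big_cons big_nil muln1 !mulnA.
  have cE : c = 1%N.
    case/orP: c12 => /eqP // c2; move: E; rewrite c2 => /sqr_mod4_diff[].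
    rewrite prodE -modnMm -(modnMm (q * r)) -(modnMm q r).
    by rewrite p_mod4 q_mod4 r_mod4 s_mod4.
  rewrite cE /= in c12 c1 rel E.
  have [ers eqr] := symbols_relation4 sym c1 rel.
  have := S_pell (Or33 _ _ prodE) (isT : (1 == 1) || (1 == 2))%N E.
  rewrite mul1n !big_cons !big_nil -ers; move: eqr.
  have Srs : S (r * s)%N -> S q.
    by move=> Srs; apply: (S_div _ Srs); rewrite ?muln_gt0 ?r0 // [X in S X]mulnC mulnA.
  case: (e p); case: (e q); case: (e r) => //= _; rewrite ?muln1 // => Sx.
  - exact: (S_div p0 S_p Sx).
  - by apply: Srs; apply: (S_div p0 S_p Sx).
have Srs : S (r * s)%N by apply: (S_div q0 Sq); rewrite mulnA.
have Sr_s : S r -> S s by move=> Sr; apply: (S_div r0 Sr).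
have Ss_r : S s -> S r by move=> Ss; apply: (S_div s0 Ss); rewrite mulnC.
suff S_rs : S r \/ S s.
  by case: S_rs => [Sr | Ss]; split=> //; by [apply: Sr_s | apply: Ss_r].
have q3 : primes3mod4 [:: q; r; s].
  by move: p34; rewrite /primes3mod4 /= => /andP[/andP[_ ->] /andP[_ ->]].
have [//|c [u [v [e [c12 E c1 rel]]]]] := pell_relation q3 _.
have prodE : ((\prod_(m <- [:: q; r; s] | ~~ e m) m) *
    (\prod_(m <- [:: q; r; s] | e m) m) = q * r * s)%N.
  by rewrite prod_compl !big_cons big_nil muln1 !mulnA.
have := symbols_relation3 sym c12 c1 rel.
have := S_pell (Or32 _ _ prodE) c12 E.
have Sd x : S (c * x)%N -> S x.
  by case/orP: c12 => /eqP ->; [rewrite mul1n | apply: S_div].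
rewrite !big_cons !big_nil.
case: (e q); case: (e r); case: (e s) => //=; rewrite ?muln1 => /Sd Sx _.
- by left; apply: (S_div q0 Sq Sx).
- by right; apply: (S_div q0 Sq Sx).
- by left.
- by right.
Qed.
End Generation.
End Arith.

Local Open Scope classical_set_scope.

(** * The ring of integers and its maximal ideals *)

Section Integers.
Variable K : fieldExtType rat.
Local Notation OK := (@ringOfIntegers K).
Implicit Types (x y : K) (I J m : set K).

Lemma OKD x y : OK x -> OK y -> OK (x + y). Proof. exact: integral_add. Qed.
Lemma OKM x y : OK x -> OK y -> OK (x * y). Proof. exact: integral_mul. Qed.
Lemma OKB x y : OK x -> OK y -> OK (x - y). Proof. exact: integral_sub. Qed.
Lemma OKN x : OK x -> OK (- x). Proof. exact: integral_opp. Qed.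
Lemma OK_int (z : int) : OK z%:~R. Proof. exact: integral_id. Qed.
Lemma OK_nat n : OK n%:R. Proof. exact: integral_nat. Qed.
Lemma OK1 : OK 1. Proof. exact: (OK_nat 1). Qed.
Lemma OK0 : OK 0. Proof. exact: (OK_nat 0). Qed.

Lemma OK_quadratic x u v : OK u -> OK v -> x ^+ 2 = u * x + v -> OK x.
Proof.
move=> Ou Ov xE.
have PE : Poly [:: - v; - u; 1] = [:: - v; - u; 1] :> seq K.
  by rewrite (@PolyK _ 0) //= oner_neq0.
apply: (@integral_root_monic _ _ _ x (Poly [:: - v; - u; 1])).
- by rewrite monicE lead_coefE PE.
- by rewrite /root horner_Poly /=; apply/eqP; move: xE; rewrite expr2 => xE; ring: xE.
- by rewrite PE => y; rewrite !inE => /or3P[]/eqP->; [apply: OKN | apply: OKN | apply: OK1].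
Qed.

Lemma OK_sqrt x : OK (x ^+ 2) -> OK x.
Proof. by move=> O2; apply: (OK_quadratic OK0 O2); rewrite mul0r add0r. Qed.

(** Z is integrally closed; the statement about algebraic numbers is applied to the
image of c. *)
Lemma OK_rat (c : rat) : OK (in_alg K c) -> c \is a Num.int.
Proof.
case=> P monP rootP.
have rootQ : root (map_poly (intr : int -> rat) P) c.
  rewrite -(fmorph_root (in_alg K)) -map_poly_comp.
  by rewrite (eq_map_poly (g := intr)) // => z; exact: (rmorph_int (in_alg K)).
suff : ratr c \in (Num.int : {pred algC}).
  case/intrP => z zE; apply/intrP; exists z.
  apply: (@fmorph_inj _ _ (ratr : {rmorphism rat -> algC})).
  by rewrite /= zE rmorph_int.
apply: Cint_rat_Aint; first by rewrite Crat_rat.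
apply: (@root_monic_Aint (map_poly intr P)).
- have -> : map_poly intr P = map_poly (ratr : rat -> algC) (map_poly intr P).
    by rewrite -map_poly_comp; apply: eq_map_poly => z; rewrite /= rmorph_int.
  by rewrite fmorph_root.
- exact: monic_map.
- by apply/polyOverP => i; rewrite coef_map /= rpred_int.
Qed.
End Integers.

Section Ideals.
Variable K : fieldExtType rat.
Local Notation OK := (@ringOfIntegers K).
Implicit Types (x y z : K) (I J m : set K).

Lemma ideal_add I x y : is_ideal I -> I x -> I y -> I (x + y).
Proof. by case=> _ _ + _; apply. Qed.

Lemma ideal_mulOl I x y : is_ideal I -> OK x -> I y -> I (x * y).
Proof. by case=> _ _ _; apply. Qed.

Lemma ideal_mulOr I x y : is_ideal I -> I x -> OK y -> I (x * y).
Proof. by move=> Ii Ix Oy; rewrite mulrC; apply: ideal_mulOl. Qed.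

Lemma ideal_opp I x : is_ideal I -> I x -> I (- x).
Proof. by move=> Ii Ix; rewrite -mulN1r; apply: ideal_mulOl => //; apply/OKN/OK1. Qed.

Lemma ideal_sub I x y : is_ideal I -> I x -> I y -> I (x - y).
Proof. by move=> Ii Ix Iy; apply: ideal_add => //; apply: ideal_opp. Qed.

Lemma ideal_zero I : is_ideal I -> I 0. Proof. by case. Qed.

Lemma ideal_int I x : is_ideal I -> I x -> OK x. Proof. by case=> + _ _ _; apply. Qed.

Lemma ideal_sum I T (s : seq T) (F : T -> K) : is_ideal I ->
  (forall i, I (F i)) -> I (\sum_(i <- s) F i).
Proof.
by move=> Ii IF; elim/big_ind: _ => //; [apply: ideal_zero|move=> x y; apply: ideal_add].
Qed.

Lemma ideal_eqO I : is_ideal I -> I 1 -> I = OK.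
Proof.
move=> Ii I1; apply/seteqP; split=> x; first exact: ideal_int.
by move=> Ox; rewrite -[x]mulr1; apply: ideal_mulOl.
Qed.

(** The ideal m + x O_K is the whole ring. *)
Lemma maximal_comaximal m x : is_maximal_ideal m -> OK x -> ~ m x ->
  exists w, OK w /\ m (1 - w * x).
Proof.
case=> mi mO mmax Ox nmx.
pose J := [set y | exists z w, [/\ m z, OK w & y = z + w * x]].
have Ji : is_ideal J.
  split.
  - by move=> _ [z [w [mz Ow ->]]]; apply: OKD; [exact: (ideal_int mi)|exact: OKM].
  - by exists 0, 0; split; [exact: ideal_zero|exact: OK0|rewrite mul0r addr0].
  - move=> _ _ [z1 [w1 [mz1 Ow1 ->]]] [z2 [w2 [mz2 Ow2 ->]]].
    exists (z1 + z2), (w1 + w2); split; [exact: ideal_add|exact: OKD|ring].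
  - move=> a _ Oa [z [w [mz Ow ->]]].
    exists (a * z), (a * w); split; [exact: ideal_mulOl|exact: OKM|ring].
have mJ : m `<=` J.
  by move=> z mz; exists z, 0; split=> //; [exact: OK0|rewrite mul0r addr0].
have [Jm|JO] := mmax J Ji mJ.
  case: nmx; rewrite -Jm; exists 0, 1; split; [exact: ideal_zero|exact: OK1|].
  by rewrite add0r mul1r.
have : J 1 by rewrite JO; exact: OK1.
by case=> z [w [mz Ow E]]; exists w; split=> //; rewrite E addrK.
Qed.

Lemma maximal_prime m x y : is_maximal_ideal m -> OK x -> OK y ->
  m (x * y) -> m x \/ m y.
Proof.
move=> mM Ox Oy mxy; have [mx|nmx] := pselect (m x); [by left|right].
have [w [Ow mw]] := maximal_comaximal mM Ox nmx; have [mi _ _] := mM.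
have -> : y = (1 - w * x) * y + w * (x * y) by ring.
by apply: ideal_add => //; [apply: ideal_mulOr|apply: ideal_mulOl].
Qed.

Lemma maximal_not1 m : is_maximal_ideal m -> ~ m 1.
Proof. by case=> mi mO _ m1; apply/mO/ideal_eqO. Qed.

Lemma maximal_sub m m' : is_maximal_ideal m -> is_maximal_ideal m' ->
  m `<=` m' -> m = m'.
Proof. by case=> _ _ mM [m'i m'O _] /(mM _ m'i)[->|]. Qed.

(** The translation by 1 permutes the residues modulo m, so that the sum of all
residues equals itself plus the number of residues. *)
Lemma ideal_norm_mem m : is_ideal m -> (0 < ideal_norm m)%N ->
  m (ideal_norm m)%:R.
Proof.
move=> mi; rewrite /ideal_norm; set C := [set _ | a in OK] => C_gt0.
have finC : finite_set C.
  by apply: contrapT => infC; move: C_gt0; rewrite /fset_set; case: pselect => //.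
pose coset a : set K := [set a + x | x in m].
have cosetP a b : (coset a = coset b) <-> m (a - b).
  split=> [E|mab].
    have [x mx ax] : coset b a by rewrite -E; exists 0; [exact: ideal_zero|rewrite addr0].
    by rewrite -ax addrC addKr.
  apply/seteqP; split=> _ [x mx <-].
    by exists (a - b + x); [exact: ideal_add|ring].
  by exists (x - (a - b)); [exact: ideal_sub|ring].
have repP c : exists a, c \in fset_set C -> OK a /\ c = coset a.
  have [cC|] := boolP (c \in fset_set C); last by exists 0.
  by move: cC; rewrite in_fset_set // inE => -[a Oa <-]; exists a.
pose rep c := xget 0 [set a | c \in fset_set C -> OK a /\ c = coset a].
have {}repP c : c \in fset_set C -> OK (rep c) /\ c = coset (rep c).
  by rewrite /rep; case: xgetP => [a -> //|/(_ _) no]; have [a /no] := repP c.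
pose shift c := coset (1 + rep c).
have shiftC c : c \in fset_set C -> shift c \in fset_set C.
  case/repP => Oc _; rewrite in_fset_set // inE.
  by exists (1 + rep c) => //; apply: OKD => //; apply: OK1.
pose s := enum_fset (fset_set C).
have us : uniq s by exact: fset_uniq.
have us' : uniq (map shift s).
  rewrite map_inj_in_uniq // => c d /repP[_ cE] /repP[_ dE] /cosetP.
  have -> : 1 + rep c - (1 + rep d) = rep c - rep d by ring.
  by move/cosetP; rewrite -cE -dE.
have perm_s : perm_eq (map shift s) s.
  have sub : {subset map shift s <= s} by move=> _ /mapP[c cs ->]; apply: shiftC.
  by apply: uniq_perm => //; apply: (uniq_min_size us' sub _).2; rewrite size_map.
have : m (\sum_(c <- s) (1 + rep c - rep (shift c))).
  rewrite big_seq; elim/big_ind: _ => //; [exact: ideal_zero|by move=> x y; apply: ideal_add|].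
  move=> c cs; apply/cosetP; by have [_ <-] := repP _ (shiftC c cs).
rewrite sumrB big_split /= -(big_map shift predT rep) (perm_big _ perm_s) /= addrK.
by rewrite big_const_seq count_predT iter_addr_0 cardfE.
Qed.

(** The element y comes from multiplying, over the ideals of s, elements that are 1
modulo m. *)
Lemma maximal_list_comaximal m (s : seq (set K)) : is_maximal_ideal m ->
  (forall m', m' \in s -> is_maximal_ideal m') -> m \notin s ->
  exists y, [/\ OK y, m (1 - y) & forall m', m' \in s -> m' y].
Proof.
move=> mM; elim: s => [|m' s ih] sM ms.
  by exists 1; split=> //; [exact: OK1|rewrite subrr; apply: ideal_zero; case: mM].
have m'M := sM m' (mem_head _ _).
have [||y [Oy my sy]] := ih.
- by move=> n ns; apply: sM; rewrite inE ns orbT.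
- by apply: contra ms => ms; rewrite inE ms orbT.
have [mi _ _] := mM.
have [x m'x nmx] : exists2 x, m' x & ~ m x.
  apply: contrapT => H; move: ms; rewrite inE negb_or => /andP[/eqP[]].
  apply/esym/maximal_sub => // x m'x; apply: contrapT => nmx; apply: H; by exists x.
have [m'i _ _] := m'M; have Ox := ideal_int m'i m'x.
have [w [Ow mw]] := maximal_comaximal mM Ox nmx.
exists (y * (w * x)); split; first by do ![apply: OKM => //].
  have -> : 1 - y * (w * x) = (1 - y) + y * (1 - w * x) by ring.
  by apply: ideal_add => //; apply: ideal_mulOl.
move=> n; rewrite inE => /orP[/eqP->|ns].
  by do 2!apply: ideal_mulOl => //.
have [ni _ _] : is_maximal_ideal n by apply: sM; rewrite inE ns orbT.
by apply: ideal_mulOr; [|exact: sy|exact: OKM].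
Qed.

(** With y as in [maximal_list_comaximal], an element x of all ideals is
(1 - y) x + x y, a sum of two products. *)
Lemma prod_maximal (s : seq (set K)) : uniq s ->
  (forall m, m \in s -> is_maximal_ideal m) ->
  \big[@ideal_mul K/OK]_(m <- s) m = [set x | OK x /\ forall m, m \in s -> m x].
Proof.
elim: s => [|m s ih] /= => [_ _|/andP[ms us] sM].
  by rewrite big_nil; apply/seteqP; split=> [x Ox|x []].
rewrite big_cons ih //; last by move=> n ns; apply: sM; rewrite inE ns orbT.
have mM := sM m (mem_head _ _); have [mi _ _] := mM.
have sM' n : n \in s -> is_maximal_ideal n by move=> ns; apply: sM; rewrite inE ns orbT.
have [y [Oy my sy]] := maximal_list_comaximal mM sM' ms.
apply/seteqP; split=> x.
  case=> n [u [v [mu sv ->]]]; split.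
    elim/big_ind: _ => [|? ?|i _]; [exact: OK0|exact: OKD|].
    by apply: OKM; [exact: (ideal_int mi)|have [] := sv i].
  move=> m'; rewrite inE => /orP[/eqP->|m's].
    by apply: ideal_sum => // i; apply: ideal_mulOr => //; have [] := sv i.
  have [m'i _ _] := sM' m' m's; apply: ideal_sum => // i; apply: ideal_mulOl => //.
    exact: (ideal_int mi).
  by have [_ svi] := sv i; apply: svi.
case=> Ox sx; exists 2%N, (fun i => if i == 0 :> 'I_2 then 1 - y else x),
  (fun i => if i == 0 :> 'I_2 then x else y); split.
- by move=> i; case: ifP => _ //; apply: sx; rewrite mem_head.
- move=> i; case: ifP => _; split=> // n ns.
  by apply: sx; rewrite inE ns orbT.
- by rewrite big_ord_recl big_ord1 /=; ring.
Qed.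
End Ideals.

(** * Principality of the Ostrowski ideals *)

Section Ostrowski.
Variable K : fieldExtType rat.
Local Notation OK := (@ringOfIntegers K).
Implicit Types (x y z : K) (I J m : set K).

(** The elements of the Galois group of a biquadratic field, as plain functions. *)
Definition integral_involution (h : K -> K) :=
  [/\ {morph h : x y / x + y}, {morph h : x y / x * y}, involutive h
    & forall x, OK x -> OK (h x)].

Section Involution.
Variable h : K -> K.
Hypothesis hP : integral_involution h.

Lemma involution_ideal I : is_ideal I -> is_ideal (h @^-1` I).
Proof.
have [hD hM hK hO] := hP; move=> Ii; split=> /=.
- by move=> x /(ideal_int Ii)/hO; rewrite hK.
- have -> : h 0 = 0 by apply: (addIr (h 0)); rewrite -hD !add0r.
  exact: ideal_zero.
- by move=> x y; rewrite hD; apply: ideal_add.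
- by move=> a x Oa; rewrite hM; apply: ideal_mulOl => //; apply: hO.
Qed.

Lemma involution_preimageK I : h @^-1` (h @^-1` I) = I.
Proof. by have [_ _ hK _] := hP; apply/seteqP; split=> x /=; rewrite hK. Qed.

Lemma involution_O : h @^-1` OK = OK.
Proof.
have [_ _ hK hO] := hP; apply/seteqP; split=> x /=; last exact: hO.
by move/hO; rewrite hK.
Qed.

Lemma involution_maximal m : is_maximal_ideal m -> is_maximal_ideal (h @^-1` m).
Proof.
case=> mi mO mM; split; first exact: involution_ideal.
  by move=> E; apply: mO; rewrite -(involution_preimageK m) E involution_O.
move=> J Ji mJ; have [||E|E] := mM (h @^-1` J); first exact: involution_ideal.
- by rewrite -(involution_preimageK m) => x; apply: mJ.
- by left; rewrite -E involution_preimageK.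
- by right; rewrite -(involution_preimageK J) E involution_O.
Qed.

Lemma involution_norm m : (0 < ideal_norm m)%N ->
  ideal_norm (h @^-1` m) = ideal_norm m.
Proof.
have [hD hM hK hO] := hP; rewrite /ideal_norm.
set C' := [set _ | a in OK] => C_gt0; set C := [set _ | a in OK].
have finC' : finite_set C'.
  by apply: contrapT => infC; move: C_gt0; rewrite /fset_set; case: pselect.
have -> : C = (preimage h) @` C'.
  apply/seteqP; split=> [_ [a Oa <-]|_ [_ [a Oa <-] <-]].
    exists [set h a + x | x in m]; first by exists (h a) => //; apply: hO.
    apply/seteqP; split=> x /=.
      by case=> y my E; exists (h y); rewrite /= ?hK // -[x]hK -E hD hK.
    by case=> y my <-; exists (h y) => //; rewrite hD.
  exists (h a); first exact: hO.
  apply/seteqP; split=> x /=.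
    by case=> y my <-; exists (h y) => //; rewrite hD hK.
  by case=> y my E; exists (h y); rewrite /= ?hK // -[x]hK -E hD.
rewrite fset_set_image // card_imfset //= => c d E.
by rewrite -(involution_preimageK c) E involution_preimageK.
Qed.
End Involution.

(** A generator criterion that avoids the factorization theory of ideals. If some
maximal ideal has norm l^f, the Ostrowski ideal is the intersection of all of
them, which is one of the ideals J in the last hypothesis; if there is none it is
O_K. The hypothesis m l -> m alpha says that alpha lies in every prime above l. *)
Theorem ostrowski_principal (G : set (K -> K)) l f (alpha : K) :
  prime l -> (forall h, G h -> integral_involution h) ->
  OK alpha -> alpha != 0 ->
  (forall m, is_maximal_ideal m -> m l%:R -> m alpha) ->
  (forall J, is_ideal J -> J alpha -> (forall h, G h -> forall x, J x -> J (h x)) ->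
     (forall z : int, J z%:~R -> (l%:Z %| z)%Z) -> forall x, J x -> OK (x / alpha)) ->
  is_principal (ostrowski_ideal l f : set K).
Proof.
move=> pl GP Oa a0 ma crit; rewrite /ostrowski_ideal.
set S := [set m | _]; set s := finite_support _ _ _.
have us : uniq s by exact: finite_support_uniq.
case: (eqVneq s [::]) => [s0|s_neq0].
  rewrite s0 big_nil; exists 1; first exact: OK1.
  apply/seteqP; split=> x; first by move=> Ox; exists x => //; rewrite mul1r.
  by case=> y Oy <-; rewrite mul1r.
have sE m : m \in s <-> S m.
  rewrite in_finite_support; last first.
    by apply: contrapT => inf; move: s_neq0; rewrite /s no_finite_support.
  rewrite inE; split=> [[]//|Sm]; split=> //=.
  by case: Sm => -[].
have sM m : m \in s -> is_maximal_ideal m by case/sE.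
have sl m : m \in s -> m l%:R.
  case/sE => mM mN; have [mi _ _] := mM.
  have : m (ideal_norm m)%:R.
    by apply: ideal_norm_mem => //; rewrite mN expn_gt0 prime_gt0.
  rewrite mN; elim: f {S s us s_neq0 sE sM mN} => [|f ih].
    by move/(maximal_not1 mM).
  rewrite expnS natrM => /(maximal_prime mM) [||//|//]; exact: OK_nat.
rewrite prod_maximal //; set J := [set x | _].
have [m0 m0s] : exists m0, m0 \in s.
  by case: (s) s_neq0 => // m0 t _; exists m0; rewrite mem_head.
have Ji : is_ideal J.
  split=> [x []//||x y [Ox sx] [Oy sy]|a x Oa' [Ox sx]].
  - split=> [|m /sM[mi _ _]]; [exact: OK0|exact: ideal_zero].
  - split=> [|m ms]; first exact: OKD.
    by have [mi _ _] := sM m ms; apply: ideal_add => //; [exact: sx|exact: sy].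
  - split=> [|m ms]; first exact: OKM.
    by have [mi _ _] := sM m ms; apply: ideal_mulOl => //; exact: sx.
have Jh h : G h -> forall x, J x -> J (h x).
  move=> Gh x [Ox sx]; have hP := GP h Gh; have [_ _ _ hO] := hP.
  split=> [|m /sE[mM mN]]; first exact: hO.
  apply: (sx (h @^-1` m)); apply/sE; split; first exact: involution_maximal.
  by rewrite (involution_norm hP) // mN expn_gt0 prime_gt0.
have Jz (z : int) : J z%:~R -> (l%:Z %| z)%Z.
  case=> _ /(_ m0 m0s) m0z; apply/negPn/negP => lz.
  have [m0i _ _] := sM _ m0s; apply: (maximal_not1 (sM _ m0s)).
  have co : coprimez l%:Z z by rewrite coprimezE prime_coprime // -dvdzE.
  have [u [v uv]] := Bezoutz l%:Z z; move: uv; rewrite (eqP co) => uv.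
  have -> : 1 = u%:~R * l%:R + v%:~R * z%:~R :> K.
    by rewrite -[l%:R]/(l%:Z%:~R) -!intrM -intrD uv.
  apply: ideal_add => //; apply: ideal_mulOl => //; [exact: OK_int|exact: sl|exact: OK_int].
have Ja : J alpha by split=> // m ms; apply: ma; [exact: sM|exact: sl].
exists alpha => //; apply/seteqP; split=> x.
  move=> Jx; exists (x / alpha); first exact: crit Jx.
  by rewrite mulrC divfK.
by case=> y Oy <-; apply: ideal_mulOr.
Qed.
End Ostrowski.

(** * Units times squares *)

(** A named morphism, so that the general lemmas on morphisms rewrite the embedding of
the rationals. *)
Definition ratK (K : fieldExtType rat) : {rmorphism rat -> K} := in_alg K.

Lemma ratKE (K : fieldExtType rat) c : c%:A = ratK K c. Proof. by []. Qed.

Section Units.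
Variable K : fieldExtType rat.
Local Notation OK := (@ringOfIntegers K).
Implicit Types (x y z u : K).

Definition int_unit u := [/\ u != 0, OK u & OK u^-1].

Lemma natK_neq0 n : (0 < n)%N -> n%:R != 0 :> K.
Proof.
move=> n0; rewrite -(rmorph_nat (ratK K)) fmorph_eq0 pnatr_eq0.
by rewrite -lt0n.
Qed.

(** Divisibility by alpha can be tested on squares because O_K is integrally closed. *)
Lemma OK_div_sqrt (l : nat) (alpha u y t : K) : (0 < l)%N -> int_unit u ->
  alpha ^+ 2 = l%:R * u -> y ^+ 2 = l%:R * t -> OK t -> OK (y / alpha).
Proof.
move=> l0 [u0 Ou Ou'] aE yE Ot; apply: OK_sqrt.
rewrite expr_div_n aE yE -mulf_div divff ?natK_neq0 // mul1r.
exact: OKM.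
Qed.

(** For alpha dividing l, factors prime to l can be cancelled modulo alpha. *)
Lemma OK_div_coprime (n l : nat) (alpha x : K) : coprime n l -> OK x ->
  OK (l%:R / alpha) -> OK (n%:R * x / alpha) -> OK (x / alpha).
Proof.
move=> co Ox Ol On; have [u [v uv]] := Bezoutz n%:Z l%:Z.
have {}uv : u%:~R * n%:R + v%:~R * l%:R = 1 :> K.
  rewrite -[n%:R]/(n%:Z%:~R) -[l%:R]/(l%:Z%:~R) -!intrM -intrD uv.
  by rewrite /gcdz /= (eqP co).
have -> : x / alpha = u%:~R * (n%:R * x / alpha) + v%:~R * (l%:R / alpha) * x.
  transitivity ((u%:~R * n%:R + v%:~R * l%:R) * (x / alpha)); last by ring.
  by rewrite uv mul1r.
apply: OKD; first by apply: OKM => //; exact: OK_int.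
by apply: OKM => //; apply: OKM => //; exact: OK_int.
Qed.
End Units.

(** * Biquadratic fields *)

Lemma sqr_mod4_even (m n t k : int) : m ^+ 2 - (4 * t + 3) * n ^+ 2 = 4 * k ->
  exists i j, m = 2 * i /\ n = 2 * j.
Proof.
move=> E; exists (m %/ 2)%Z, (n %/ 2)%Z.
have [mE nE] := (divz_eq m 2, divz_eq n 2).
have m2 : (m %% 2)%Z = 0 \/ (m %% 2)%Z = 1 by lia.
have n2 : (n %% 2)%Z = 0 \/ (n %% 2)%Z = 1 by lia.
move: (m %/ 2)%Z (m %% 2)%Z (n %/ 2)%Z (n %% 2)%Z mE nE m2 n2 E.
by move=> i x j y -> -> [->|->] [->|->] E; lia.
Qed.

Lemma nonsquare_rat n (x y : rat) : nonsquare n -> x ^+ 2 = n%:R * y ^+ 2 ->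
  x = 0 /\ y = 0.
Proof.
move=> nsn E.
have y0 : y = 0.
  apply/eqP; apply: contraT => y_neq0.
  have dx : (denq x)%:~R != 0 :> rat by rewrite intr_eq0 denq_neq0.
  have dy : (denq y)%:~R != 0 :> rat by rewrite intr_eq0 denq_neq0.
  have /eqP : ((numq x * denq y)%:~R ^+ 2 = (n%:R * (numq y * denq x)%:~R ^+ 2) :> rat).
    rewrite !intrM !numqE !exprMn E; ring.
  rewrite -[n%:R]/(n%:Z%:~R) -!rmorphXn -rmorphM /= eqr_int => /eqP/(congr1 absz).
  rewrite abszM !abszX /= => E'.
  have pos : (0 < `|(numq y * denq x)%R|)%N.
    by rewrite absz_gt0 mulf_neq0 // ?numq_eq0 // denq_neq0.
  by have := nonsquare_mul `|(numq x * denq y)%R| nsn pos; rewrite E' eqxx.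
by split=> //; move/eqP: E; rewrite y0 expr0n mulr0 expf_eq0 => /eqP.
Qed.

Section Biquadratic.
Variables (K : fieldExtType rat) (A B : nat) (a b : K).
Local Notation OK := (@ringOfIntegers K).
Local Notation Q := (ratK K).
Hypotheses (aE : a ^+ 2 = A%:R) (bE : b ^+ 2 = B%:R).
Hypotheses (nsA : nonsquare A) (nsB : nonsquare B) (nsAB : nonsquare (A * B)).
Hypothesis gen : <<1 & [:: a; b]>>%VS = {:K}%VS.

Definition of_coords (c0 c1 c2 c3 : rat) : K := Q c0 + Q c1 * a + Q c2 * b + Q c3 * (a * b).

Lemma Q_inj : injective Q. Proof. exact: fmorph_inj. Qed.

Lemma lin_indep1 c0 c1 : Q c0 + Q c1 * a = 0 -> c0 = 0 /\ c1 = 0.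
Proof.
move=> E; apply: (nonsquare_rat nsA); apply: Q_inj.
have {}E : Q c0 = - (Q c1 * a) by apply/eqP; rewrite -addr_eq0 E.
by rewrite rmorphXn rmorphM rmorphXn rmorph_nat E -aE; ring.
Qed.

(** Linear independence of 1, a, b, ab. Comparing (c0 + c1 a)^2 with
B (c2 + c3 a)^2 gives rational equations whose nonzero solutions would make one of
B and A B a square. *)
Lemma of_coords_eq0 c0 c1 c2 c3 : of_coords c0 c1 c2 c3 = 0 ->
  [/\ c0 = 0, c1 = 0, c2 = 0 & c3 = 0].
Proof.
rewrite /of_coords => E.
have {E} E : Q c0 + Q c1 * a = - ((Q c2 + Q c3 * a) * b).
  by apply/eqP; rewrite -addr_eq0 -E; apply/eqP; ring.
have : Q (c0 ^+ 2 + A%:R * c1 ^+ 2 - B%:R * (c2 ^+ 2 + A%:R * c3 ^+ 2)) +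
       Q (2%:R * (c0 * c1 - B%:R * (c2 * c3))) * a = 0.
  transitivity ((Q c0 + Q c1 * a) ^+ 2 - b ^+ 2 * (Q c2 + Q c3 * a) ^+ 2).
    rewrite bE !(rmorphB, rmorphD, rmorphM, rmorphXn, rmorph_nat) -aE; ring.
  by rewrite E; ring.
case/lin_indep1 => E1 /eqP; rewrite mulf_eq0 pnatr_eq0 /= subr_eq0 => /eqP E2.
have : (c0 ^+ 2 - A%:R * c1 ^+ 2) ^+ 2 = (B%:R * (c2 ^+ 2 - A%:R * c3 ^+ 2)) ^+ 2.
  transitivity ((c0 ^+ 2 + A%:R * c1 ^+ 2) ^+ 2 - 4%:R * A%:R * (c0 * c1) ^+ 2); first by ring.
  move/eqP: E1; rewrite subr_eq0 => /eqP->; rewrite E2; ring.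
have A0 : A%:R != 0 :> rat.
  by rewrite pnatr_eq0 eq_sym; have := nsA 0.
move/eqP; rewrite eqf_sqr => /orP[]/eqP E3.
  have H : c0 ^+ 2 = B%:R * c2 ^+ 2 by lra.
  have H' : A%:R * c1 ^+ 2 = A%:R * (B%:R * c3 ^+ 2) by lra.
  have [-> ->] := nonsquare_rat nsB H.
  by have [-> ->] := nonsquare_rat nsB (mulfI A0 H').
have H : c0 ^+ 2 = (A * B)%:R * c3 ^+ 2 by rewrite natrM; lra.
have H' : A%:R * c1 ^+ 2 = B%:R * c2 ^+ 2 by lra.
have [-> ->] := nonsquare_rat nsAB H.
have H'' : (A%:R * c1) ^+ 2 = (A * B)%:R * c2 ^+ 2.
  by rewrite natrM -mulrA -H' exprMn expr2 mulrA.
have [/eqP + ->] := nonsquare_rat nsAB H''.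
by rewrite mulf_eq0 (negbTE A0) => /eqP->.
Qed.

Lemma of_coordsP x : exists c0 c1 c2 c3, x = of_coords c0 c1 c2 c3.
Proof.
pose V := <<[:: 1%R; a; b; (a * b)%R]>>%VS.
have VP y : y \in V -> exists c0 c1 c2 c3, y = of_coords c0 c1 c2 c3.
  rewrite /V !span_cons span_nil addv0.
  case/memv_addP => _ /vlineP[c0 ->] [_ /memv_addP[_ /vlineP[c1 ->]
    [_ /memv_addP[_ /vlineP[c2 ->] [_ /vlineP[c3 ->] ->]] ->]] ->].
  by exists c0, c1, c2, c3; rewrite /of_coords -!ratKE -!scalerAl !mul1r !addrA.
have formV c0 c1 c2 c3 : of_coords c0 c1 c2 c3 \in V.
  rewrite /of_coords -!ratKE -!scalerAl !mul1r.
  by rewrite !memvD // memvZ // memv_span // !inE eqxx ?orbT.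
apply: (VP); have : x \in <<1 & [:: a; b]>>%VS by rewrite gen memvf.
apply/subvP/agenv_sub_modl.
  by rewrite -memvE memv_span // mem_head.
apply/prodvP => u v.
rewrite !span_cons span_nil addv0.
case/memv_addP => _ /vlineP[k ->] [_ /memv_addP[_ /vlineP[i ->] [_ /vlineP[j ->] ->]] ->].
case/VP => c0 [c1 [c2 [c3 ->]]].
suff -> : (k *: 1 + (i *: a + j *: b)) * of_coords c0 c1 c2 c3 =
   of_coords (k * c0 + i * A%:R * c1 + j * B%:R * c2)
        (k * c1 + i * c0 + j * B%:R * c3)
        (k * c2 + i * A%:R * c3 + j * c0) (k * c3 + i * c2 + j * c1) by [].
have -> : k *: 1 + (i *: a + j *: b) = Q k + Q i * a + Q j * b.
  by rewrite -!ratKE -!scalerAl !mul1r addrA.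
rewrite /of_coords !(rmorphD, rmorphM, rmorph_nat) -aE -bE; ring.
Qed.

Definition coords (x : K) : rat * rat * rat * rat :=
  xget (0, 0, 0, 0) [set c | x = of_coords c.1.1.1 c.1.1.2 c.1.2 c.2].

(** The automorphism a -> i a, b -> j b, for i and j equal to 1 or -1. *)
Definition biquad_conj (i j : rat) (x : K) : K :=
  let: (c0, c1, c2, c3) := coords x in of_coords c0 (i * c1) (j * c2) (i * j * c3).

Lemma conj_of_coords i j c0 c1 c2 c3 :
  biquad_conj i j (of_coords c0 c1 c2 c3) = of_coords c0 (i * c1) (j * c2) (i * j * c3).
Proof.
rewrite /biquad_conj /coords; case: xgetP => [[[[d0 d1] d2] d3] _ /= E | no]; last first.
  by case: (no (c0, c1, c2, c3)).
suff [-> -> -> ->] : [/\ c0 = d0, c1 = d1, c2 = d2 & c3 = d3] by [].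
have [] := @of_coords_eq0 (c0 - d0) (c1 - d1) (c2 - d2) (c3 - d3).
  rewrite -(subrr (of_coords d0 d1 d2 d3)) -{1}E /of_coords !rmorphB; ring.
by move=> /eqP + /eqP + /eqP + /eqP +; rewrite !subr_eq0 => /eqP-> /eqP-> /eqP-> /eqP->.
Qed.

Section Conjugation.
Variables (i j : rat).
Hypotheses (ii : i ^+ 2 = 1) (jj : j ^+ 2 = 1).
Local Notation h := (biquad_conj i j).

Lemma conjD : {morph h : x y / x + y}.
Proof.
move=> x y; have [c0 [c1 [c2 [c3 ->]]]] := of_coordsP x; have [d0 [d1 [d2 [d3 ->]]]] := of_coordsP y.
have -> : of_coords c0 c1 c2 c3 + of_coords d0 d1 d2 d3 =
    of_coords (c0 + d0) (c1 + d1) (c2 + d2) (c3 + d3).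
  rewrite /of_coords !rmorphD; ring.
rewrite !conj_of_coords /of_coords !(rmorphD, rmorphM); ring.
Qed.

Lemma conjM : {morph h : x y / x * y}.
Proof.
move=> x y; have [c0 [c1 [c2 [c3 ->]]]] := of_coordsP x; have [d0 [d1 [d2 [d3 ->]]]] := of_coordsP y.
have -> : of_coords c0 c1 c2 c3 * of_coords d0 d1 d2 d3 =
    of_coords (c0 * d0 + A%:R * (c1 * d1) + B%:R * (c2 * d2) + A%:R * (B%:R * (c3 * d3)))
         (c0 * d1 + c1 * d0 + B%:R * (c2 * d3 + c3 * d2))
         (c0 * d2 + c2 * d0 + A%:R * (c1 * d3 + c3 * d1))
         (c0 * d3 + c3 * d0 + c1 * d2 + c2 * d1).
  rewrite /of_coords !(rmorphD, rmorphM, rmorph_nat) -aE -bE; ring.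
rewrite !conj_of_coords /of_coords.
have ii' : Q i ^+ 2 = 1 by rewrite -rmorphXn ii rmorph1.
have jj' : Q j ^+ 2 = 1 by rewrite -rmorphXn jj rmorph1.
rewrite !(rmorphD, rmorphM, rmorph_nat) -aE -bE; ring: ii' jj'.
Qed.

Lemma conjK : involutive h.
Proof.
move=> x; have [c0 [c1 [c2 [c3 ->]]]] := of_coordsP x; rewrite !conj_of_coords.
by rewrite !mulrA -!expr2 ii jj !mul1r [i * j * i]mulrAC -expr2 ii mul1r -expr2 jj mul1r.
Qed.

Lemma conj_ratK c : h (Q c) = Q c.
Proof.
have -> : Q c = of_coords c 0 0 0 by rewrite /of_coords rmorph0; ring.
by rewrite conj_of_coords !mulr0.
Qed.

Lemma conj_integral x : OK x -> OK (h x).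
Proof.
case=> P monP Px0; exists P => //; apply/rootP.
suff <- : h (map_poly intr P).[x] = (map_poly intr P).[h x].
  by rewrite (rootP Px0) -[0](rmorph0 Q) conj_ratK.
elim/poly_ind: P {monP Px0} => [|P c ih]; first by rewrite rmorph0 !horner0 -(rmorph0 Q) conj_ratK.
rewrite rmorphD rmorphM /= map_polyX map_polyC /= !hornerMXaddC conjD conjM ih.
by rewrite -(rmorph_int Q) conj_ratK.
Qed.

Lemma conj_involution : integral_involution h.
Proof. split; [exact: conjD|exact: conjM|exact: conjK|exact: conj_integral]. Qed.
End Conjugation.

Let Oa : OK a. Proof. by apply: OK_sqrt; rewrite aE; apply: OK_nat. Qed.
Let Ob : OK b. Proof. by apply: OK_sqrt; rewrite bE; apply: OK_nat. Qed.

Definition galois_group : set (K -> K) :=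
  [set h | exists i j, [/\ i ^+ 2 = 1, j ^+ 2 = 1 & h = biquad_conj i j]].

Lemma galois_involution h : galois_group h -> integral_involution h.
Proof. by case=> i [j [ii jj ->]]; apply: conj_involution. Qed.

(** * Divisibility at the odd primes *)

Section Ideal.
Variables (l : nat) (J : set K).
Hypotheses (l_gt0 : (0 < l)%N) (Ji : is_ideal J).
Hypothesis Jh : forall h, galois_group h -> forall x, J x -> J (h x).
Hypothesis Jz : forall z : int, J z%:~R -> (l%:Z %| z)%Z.

Lemma stable_conj i j x : i ^+ 2 = 1 -> j ^+ 2 = 1 -> J x -> J (biquad_conj i j x).
Proof. by move=> ii jj; apply: Jh; exists i, j. Qed.

Lemma rational_mem c : J (Q c) -> exists n : int, c = l%:R * n%:~R.
Proof.
move=> Jc; have /intrP[z cE] := OK_rat (ideal_int Ji Jc).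
have /dvdzP[n zE] : (l%:Z %| z)%Z by apply: Jz; rewrite -(rmorph_int Q) -cE.
by exists n; rewrite cE zE intrM mulrC.
Qed.

(** The sum of the four conjugates of x is 4 c0; it is a rational element of J. *)
Lemma trace_coord c0 c1 c2 c3 : J (of_coords c0 c1 c2 c3) ->
  exists n : int, 4%:R * c0 = l%:R * n%:~R.
Proof.
move=> Jx; apply: rational_mem.
have -> : Q (4%:R * c0) = of_coords c0 c1 c2 c3 + biquad_conj (-1) 1 (of_coords c0 c1 c2 c3)
   + (biquad_conj 1 (-1) (of_coords c0 c1 c2 c3) + biquad_conj (-1) (-1) (of_coords c0 c1 c2 c3)).
  rewrite !conj_of_coords /of_coords !(rmorphM, rmorphN, rmorph1, rmorph_nat); ring.
by do 2?apply: ideal_add => //; apply: stable_conj => //; rewrite ?sqrrN expr1n.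
Qed.

(** Multiplication by a, b and ab moves the other coordinates to the first place. *)
Lemma trace_coords c0 c1 c2 c3 : J (of_coords c0 c1 c2 c3) ->
  exists n0 n1 n2 n3 : int,
    [/\ 4%:R * c0 = l%:R * n0%:~R, 4%:R * (A%:R * c1) = l%:R * n1%:~R,
        4%:R * (B%:R * c2) = l%:R * n2%:~R
      & 4%:R * (A%:R * (B%:R * c3)) = l%:R * n3%:~R].
Proof.
move=> Jx; have [n0 E0] := trace_coord Jx.
have [n1 E1] : exists n : int, 4%:R * (A%:R * c1) = l%:R * n%:~R.
  apply: (@trace_coord _ c0 (A%:R * c3) c2).
  have -> : of_coords (A%:R * c1) c0 (A%:R * c3) c2 = of_coords c0 c1 c2 c3 * a.
    rewrite /of_coords !(rmorphM, rmorph_nat) -aE; ring.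
  exact: ideal_mulOr.
have [n2 E2] : exists n : int, 4%:R * (B%:R * c2) = l%:R * n%:~R.
  apply: (@trace_coord _ (B%:R * c3) c0 c1).
  have -> : of_coords (B%:R * c2) (B%:R * c3) c0 c1 = of_coords c0 c1 c2 c3 * b.
    rewrite /of_coords !(rmorphM, rmorph_nat) -bE; ring.
  exact: ideal_mulOr.
have [n3 E3] : exists n : int, 4%:R * (A%:R * (B%:R * c3)) = l%:R * n%:~R.
  apply: (@trace_coord _ (B%:R * c2) (A%:R * c1) c0).
  have -> : of_coords (A%:R * (B%:R * c3)) (B%:R * c2) (A%:R * c1) c0 = of_coords c0 c1 c2 c3 * (a * b).
    rewrite /of_coords !(rmorphM, rmorph_nat) -aE -bE; ring.
  by apply: ideal_mulOr => //; exact: OKM.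
by exists n0, n1, n2, n3.
Qed.

Lemma trace_lattice x : J x -> exists n0 n1 n2 n3 : int,
  (4 * A * B)%:R * x = l%:R * (n0%:~R * (A%:R * B%:R) + n1%:~R * (B%:R * a)
     + n2%:~R * (A%:R * b) + n3%:~R * (a * b)).
Proof.
have [c0 [c1 [c2 [c3 ->]]]] := of_coordsP x.
case/trace_coords => n0 [n1 [n2 [n3 [E0 E1 E2 E3]]]]; exists n0, n1, n2, n3.
transitivity (A%:R * B%:R * Q (4%:R * c0) + B%:R * a * Q (4%:R * (A%:R * c1))
  + A%:R * b * Q (4%:R * (B%:R * c2)) + a * b * Q (4%:R * (A%:R * (B%:R * c3)))).
  rewrite /of_coords !natrM !(rmorphM, rmorph_nat); ring.
rewrite E0 E1 E2 E3 !(rmorphM, rmorph_nat, rmorph_int); ring.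
Qed.

Lemma unramified_div x : coprime (4 * A * B) l -> J x -> OK (x / l%:R).
Proof.
move=> co Jx; have l0 := natK_neq0 K l_gt0.
apply: (OK_div_coprime co); first exact: (ideal_int Ji).
  by rewrite divff //; apply: OK1.
have [n0 [n1 [n2 [n3 ->]]]] := trace_lattice Jx; rewrite mulrAC divff // mul1r.
by do ![apply: OKD]; (apply: OKM; first exact: OK_int);
  apply: OKM => //; exact: OK_nat.
Qed.

(** After division by l the lattice of [trace_lattice] is spanned by AB, Ba, Ab, ab,
whose squares are multiples of AB and therefore of l = alpha^2 / u. *)
Lemma ramified_div (alpha u x : K) (k : nat) : int_unit u -> alpha ^+ 2 = l%:R * u ->
  (A * B = k * l)%N -> coprime (4 * k) l -> J x -> OK (x / alpha).
Proof.
move=> uU aaE kE co Jx; have l0 := natK_neq0 K l_gt0.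
have dv y t : y ^+ 2 = l%:R * t -> OK t -> OK (y / alpha).
  exact: OK_div_sqrt l_gt0 uU aaE.
apply: (OK_div_coprime co); first exact: (ideal_int Ji).
  by apply: (dv _ l%:R); [rewrite expr2|exact: OK_nat].
have ABk : A%:R * B%:R = l%:R * k%:R :> K by rewrite -!natrM kE mulnC.
have [n0 [n1 [n2 [n3 E]]]] := trace_lattice Jx.
have {}E : (4 * k)%:R * x = n0%:~R * (A%:R * B%:R) + n1%:~R * (B%:R * a)
     + n2%:~R * (A%:R * b) + n3%:~R * (a * b).
  by apply: (mulfI l0); rewrite -E -mulnA kE !natrM; ring.
have AB_div y t : y ^+ 2 = A%:R * B%:R * t -> OK t -> OK (y / alpha).
  move=> yE Ot; apply: (dv _ (k%:R * t)); first by rewrite yE ABk mulrA.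
  by apply: OKM => //; exact: OK_nat.
rewrite E !mulrDl -!(mulrA (_%:~R)).
do ![apply: OKD]; (apply: OKM; first exact: OK_int).
- by apply: (AB_div _ (A%:R * B%:R)); [ring|rewrite -natrM; exact: OK_nat].
- by apply: (AB_div _ B%:R); [rewrite exprMn aE; ring|exact: OK_nat].
- by apply: (AB_div _ A%:R); [rewrite exprMn bE; ring|exact: OK_nat].
- by apply: (AB_div _ 1); [rewrite exprMn aE bE; ring|exact: OK1].
Qed.
End Ideal.

(** * Divisibility at the prime 2 *)

Hypotheses (A4 : A = 3 %[mod 4]) (B4 : B = 3 %[mod 4]).

(** With y = (m + n w) / 2 and its conjugate m - y, the norm of y is a rational
integer. *)
Lemma OK_half_norm M (w : K) (m n : int) : w ^+ 2 = M%:R ->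
  OK (Q (m%:~R / 2%:R) + Q (n%:~R / 2%:R) * w) ->
  exists k : int, m ^+ 2 - M%:Z * n ^+ 2 = 4 * k.
Proof.
move=> wE; set y := Q _ + _ => Oy.
have : OK (y * (m%:~R - y)) by apply: OKM => //; apply: OKB => //; exact: OK_int.
have -> : y * (m%:~R - y) = Q ((m%:~R ^+ 2 - M%:R * n%:~R ^+ 2) / 4%:R).
  have mE : m%:~R = Q (m%:~R / 2%:R) + Q (m%:~R / 2%:R).
    by rewrite -rmorphD -(rmorph_int Q) -splitr.
  transitivity (Q (m%:~R / 2%:R) ^+ 2 - w ^+ 2 * Q (n%:~R / 2%:R) ^+ 2).
    by rewrite /y mE; ring.
  by rewrite wE -(rmorph_nat Q) -!rmorphXn -rmorphM -rmorphB; congr (Q _); field.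
move=> Oq; have /intrP[k kE] := OK_rat Oq; exists k; apply/eqP; rewrite -(eqr_int rat).
by rewrite rmorphB !rmorphM /= -kE; apply/eqP; field.
Qed.

Lemma OK_half_even M (w : K) (m n : int) : M = 3 %[mod 4] -> w ^+ 2 = M%:R ->
  OK (Q (m%:~R / 2%:R) + Q (n%:~R / 2%:R) * w) ->
  exists i j, m = 2 * i /\ n = 2 * j.
Proof.
move=> M4 wE /(OK_half_norm wE)[k E]; apply: (@sqr_mod4_even m n (M %/ 4)%N k).
by rewrite -E; congr (_ - _ * _); rewrite {2}(divn_eq M 4) M4; lia.
Qed.

Definition theta : K := (1 + a * b) / 2%:R.

Let two0 : 2%:R != 0 :> K. Proof. exact: (@natK_neq0 K 2). Qed.

Lemma AB_mod4 : exists t, A%:R * B%:R = 4%:R * t%:R + 1 :> K.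
Proof.
exists (A * B %/ 4)%N; rewrite -!natrM natr1 {1}(divn_eq (A * B) 4) -modnMm A4 B4.
by rewrite addn1 mulnC.
Qed.

Lemma OK_theta : OK theta.
Proof.
have [t tE] := AB_mod4.
apply: (@OK_quadratic K _ 1 t%:R); [exact: OK1|exact: OK_nat|].
have -> : theta ^+ 2 = (1 + 2%:R * (a * b) + a ^+ 2 * b ^+ 2) / 4%:R.
  by rewrite /theta; field; rewrite two0 (@natK_neq0 K 4).
rewrite aE bE tE /theta; field; rewrite two0 (@natK_neq0 K 4) //.
Qed.

Lemma A_odd : exists s, A%:R = 2%:R * s%:R + 1 :> K.
Proof.
exists (A %/ 4 * 2 + 1)%N; rewrite -natrM natr1 {1}(divn_eq A 4) A4.
by congr (_ %:R); lia.
Qed.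

Lemma OK_half_sum : OK ((a + b) / 2%:R).
Proof.
have [s sE] : exists s, A%:R + B%:R = 4%:R * s%:R + 2%:R :> K.
  exists (A %/ 4 + B %/ 4 + 1)%N; rewrite -natrM -!natrD {1}(divn_eq A 4) {1}(divn_eq B 4) A4 B4.
  by congr (_ %:R); lia.
apply: OK_sqrt; have -> : ((a + b) / 2%:R) ^+ 2 = theta + s%:R.
  transitivity ((a ^+ 2 + b ^+ 2 + 2%:R * (a * b)) / 4%:R).
    by field; rewrite two0 (@natK_neq0 K 4).
  rewrite aE bE sE /theta; field; rewrite two0 (@natK_neq0 K 4) //.
by apply: OKD; [exact: OK_theta|exact: OK_nat].
Qed.

Section Ideal.
Variables (J : set K) (alpha u : K).
Hypotheses (Ji : is_ideal J) (uU : int_unit u) (aaE : alpha ^+ 2 = 2%:R * u).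
Hypothesis Ja : J alpha.
Hypothesis Jh : forall h, galois_group h -> forall x, J x -> J (h x).
Hypothesis Jz : forall z : int, J z%:~R -> (2%:Z %| z)%Z.

Let Jconj i j x := @stable_conj J Jh i j x.

Let conj_trace_a c0 c1 c2 c3 :
  of_coords c0 c1 c2 c3 + biquad_conj 1 (-1) (of_coords c0 c1 c2 c3) = Q (2%:R * c0) + Q (2%:R * c1) * a.
Proof. rewrite conj_of_coords /of_coords !(rmorphM, rmorphN, rmorph1, rmorph_nat); ring. Qed.

Let conj_trace_b c0 c1 c2 c3 :
  of_coords c0 c1 c2 c3 + biquad_conj (-1) 1 (of_coords c0 c1 c2 c3) = Q (2%:R * c0) + Q (2%:R * c2) * b.
Proof. rewrite conj_of_coords /of_coords !(rmorphM, rmorphN, rmorph1, rmorph_nat); ring. Qed.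

Let conj_trace_ab c0 c1 c2 c3 :
  of_coords c0 c1 c2 c3 + biquad_conj (-1) (-1) (of_coords c0 c1 c2 c3) =
  Q (2%:R * c0) + Q (2%:R * c3) * (a * b).
Proof. rewrite conj_of_coords /of_coords !(rmorphM, rmorphN, rmorph1, rmorph_nat); ring. Qed.

Let half4 (m : rat) : 2%:R * (m / 4%:R) = m / 2%:R.
Proof. by field. Qed.

(** Up to the odd factor A B, the elements 1, a, (a + b) / 2, theta form an integral
basis. The traces leave denominators 4; the relative traces to the three quadratic
subfields reduce them to 2, and subtracting multiples of the last two basis elements
leaves a half-integral element of Q(a), which has integer coordinates since A is
3 mod 4. *)
Lemma integral_basis x : J x -> exists j0 j1 k2 k3 : int,
  (A * B)%:R * x = j0%:~R + j1%:~R * a + k2%:~R * ((a + b) / 2%:R) + k3%:~R * theta.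
Proof.
move=> Jx.
have [m0 [m1 [m2 [m3 XE]]]] : exists m0 m1 m2 m3 : int,
   (A * B)%:R * x = of_coords (m0%:~R / 4%:R) (m1%:~R / 4%:R) (m2%:~R / 4%:R) (m3%:~R / 4%:R).
  have [n0 [n1 [n2 [n3 E]]]] := trace_lattice Ji Jh Jz Jx.
  exists (2 * A%:Z * B%:Z * n0), (2 * B%:Z * n1), (2 * A%:Z * n2), (2 * n3).
  have four0 := @natK_neq0 K 4 isT.
  apply: (mulfI four0); rewrite mulrA -natrM mulnA E /of_coords.
  rewrite !fmorph_div !rmorph_nat !rmorph_int !intrM; field.
  by [].
set X := (A * B)%:R * x in XE *.
have OX : OK X by apply: OKM; [exact: OK_nat|exact: (ideal_int Ji)].
have OhX i j : i ^+ 2 = 1 -> j ^+ 2 = 1 -> OK (biquad_conj i j X).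
  by move=> ii jj; apply: conj_integral.
have sqN1 : (-1) ^+ 2 = 1 :> rat by rewrite sqrrN expr1n.
have sq1 : 1 ^+ 2 = 1 :> rat by rewrite expr1n.
have [i0 [i1 [m0E m1E]]] : exists i j, m0 = 2 * i /\ m1 = 2 * j.
  apply: (OK_half_even A4 aE); have := OKD OX (OhX 1 (-1) sq1 sqN1).
  by rewrite XE conj_trace_a !half4.
have [_ [i2 [_ m2E]]] : exists i j, m0 = 2 * i /\ m2 = 2 * j.
  apply: (OK_half_even B4 bE); have := OKD OX (OhX (-1) 1 sqN1 sq1).
  by rewrite XE conj_trace_b !half4.
have [i3 m3E] : exists i, m3 = 2 * i.
  have abE : (a * b) ^+ 2 = (A * B)%:R by rewrite exprMn aE bE natrM.
  have [|k] := @OK_half_norm _ _ m0 m3 abE.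
    have := OKD OX (OhX (-1) (-1) sqN1 sqN1).
    by rewrite XE conj_trace_ab !half4.
  rewrite m0E {1}(divn_eq (A * B) 4) -modnMm A4 B4 => E.
  exists (m3 %/ 2)%Z; have mE := divz_eq m3 2.
  have m32 : (m3 %% 2)%Z = 0 \/ (m3 %% 2)%Z = 1 by lia.
  move: (m3 %/ 2)%Z (m3 %% 2)%Z (A * B %/ 4)%N mE m32 E => j y t -> [->|->] E; lia.
have XE' : X - i2%:~R * ((a + b) / 2%:R) - i3%:~R * theta =
   Q ((i0 - i3)%:~R / 2%:R) + Q ((i1 - i2)%:~R / 2%:R) * a.
  rewrite XE m0E m1E m2E m3E /of_coords /theta !(fmorph_div, rmorph_int, rmorph_nat) !intrB !intrM.
  by field; rewrite two0 (@natK_neq0 K 4).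
have [|j0 [j1 [e0 e1]]] := @OK_half_even A a (i0 - i3) (i1 - i2) A4 aE.
  rewrite -XE'; apply: OKB; first apply: OKB => //.
    by apply: OKM; [exact: OK_int|exact: OK_half_sum].
  by apply: OKM; [exact: OK_int|exact: OK_theta].
exists j0, j1, i2, i3; move/eqP: XE'; rewrite !subr_eq => /eqP->.
rewrite e0 e1 !(fmorph_div, rmorph_int, rmorph_nat) !intrM; field; exact: two0.
Qed.

(** Both (a - 1)^2 and alpha^2 are 2 times an integer, the second one up to a unit, so
that a = 1 modulo alpha. Hence A (A B x) is congruent to some y = m + n theta with
integers m and n. As y lies in J, so does its trace 2 m + n to Q; then n is even,
m lies in J and is even as well, and alpha divides 2. *)
Lemma ramified2_div x : J x -> OK (x / alpha).
Proof.
move=> Jx; have [u0 Ou Ou'] := uU.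
have Oal := ideal_int Ji Ja.
have alpha0 : alpha != 0.
  by apply: contraNneq (mulf_neq0 two0 u0) => al0; rewrite -aaE al0 expr0n.
have two_al : 2%:R = alpha * u^-1 * alpha by rewrite mulrAC -expr2 aaE mulfK.
have O2 : OK (2%:R / alpha) by rewrite two_al mulfK //; exact: OKM.
have [s sE] := A_odd.
have a1 : OK ((a - 1) / alpha).
  apply: (@OK_div_sqrt K 2 alpha u (a - 1) (s%:R + 1 - a)) => //.
    rewrite sqrrB aE sE; ring.
  by apply: OKB => //; apply: OKD; [exact: OK_nat|exact: OK1].
have [j0 [j1 [k2 [k3 XE]]]] := integral_basis Jx.
pose m : int := A%:Z * j0 + A%:Z * j1 + k2 * s%:Z; pose n : int := k2 + A%:Z * k3.
pose y := m%:~R + n%:~R * theta.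
pose w := A%:R * j1%:~R + k2%:~R * (theta + s%:R).
have Ow : OK w.
  apply: OKD; apply: OKM; [exact: OK_nat|exact: OK_int|exact: OK_int|].
  by apply: OKD; [exact: OK_theta|exact: OK_nat].
have XyE : A%:R * ((A * B)%:R * x) - y = w * (a - 1).
  have th_a : A%:R * ((a + b) / 2%:R) = a * (theta + s%:R).
    have -> : theta + s%:R = (A%:R + a * b) / 2%:R.
      by rewrite sE /theta; field.
    by rewrite -aE; field.
  rewrite XE /y /w /m /n !(intrD, intrM) !mulrDr.
  rewrite (mulrCA A%:R k2%:~R) th_a; ring.
clearbody m n w.
have Jy : J y.
  have -> : y = A%:R * ((A * B)%:R * x) - w * ((a - 1) / alpha) * alpha.
    by rewrite -mulrA divfK // -XyE; ring.
  apply: (ideal_sub Ji); last by apply: (ideal_mulOl Ji) => //; exact: OKM.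
  by do 2!(apply: (ideal_mulOl Ji); first exact: OK_nat).
have yE : y = of_coords (m%:~R + n%:~R / 2%:R) 0 0 (n%:~R / 2%:R).
  rewrite /y /theta /of_coords rmorphD !fmorph_div rmorph0 !rmorph_int rmorph_nat; field.
  exact: two0.
have Jn : J (2 * m + n)%:~R.
  have -> : (2 * m + n)%:~R = y + biquad_conj (-1) 1 y.
    by rewrite yE conj_trace_b mulr0 -(rmorph_int Q) rmorph0 mul0r addr0; congr (Q _);
     rewrite intrD intrM; field.
  apply: (ideal_add Ji) => //; apply: Jconj => //; by rewrite ?sqrrN expr1n.
have [n' nE] : exists n', n = n' * 2.
  have /dvdzP[k kE] := Jz Jn; exists (k - m); lia.
have J2 : J 2%:R by rewrite two_al; apply: (ideal_mulOl Ji) => //; exact: OKM.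
have [m' mE] : exists m', m = m' * 2.
  apply/dvdzP/Jz; have -> : m%:~R = y - n'%:~R * theta * 2%:R.
    by rewrite /y nE intrM; ring.
  apply: (ideal_sub Ji) => //; apply: (ideal_mulOl Ji) => //.
  by apply: OKM; [exact: OK_int|exact: OK_theta].
have Oy : OK (y / alpha).
  have -> : y / alpha = (m'%:~R + n'%:~R * theta) * (2%:R / alpha).
    by rewrite /y mE nE !intrM; ring.
  apply: OKM => //; apply: OKD; first exact: OK_int.
  by apply: OKM; [exact: OK_int|exact: OK_theta].
have oddAAB : coprime (A * (A * B)) 2.
  have odd4 M : M = 3 %[mod 4] -> odd M.
    by move=> M4; rewrite (divn_eq M 4) M4 oddD oddM andbF.
  by rewrite coprimen2 !oddM (odd4 A) ?(odd4 B).
apply: (OK_div_coprime oddAAB) => //; first exact: (ideal_int Ji).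
have -> : (A * (A * B))%:R * x / alpha = y / alpha + w * ((a - 1) / alpha).
  by rewrite [w * _]mulrA -XyE -mulrDl natrM; congr (_ / _); ring.
by apply: OKD => //; exact: OKM.
Qed.
End Ideal.
End Biquadratic.

(** * The generators *)

Section UnitSquare.
Variable K : fieldExtType rat.
Local Notation OK := (@ringOfIntegers K).

Definition unit_square_class (n : nat) :=
  exists alpha u : K, int_unit u /\ alpha ^+ 2 = n%:R * u.

Lemma int_unit_mul (u v : K) : int_unit u -> int_unit v -> int_unit (u * v).
Proof.
move=> [u0 Ou Ou'] [v0 Ov Ov']; split; [exact: mulf_neq0|exact: OKM|].
by rewrite invfM; exact: OKM.
Qed.

Lemma int_unit_inv (u : K) : int_unit u -> int_unit u^-1.
Proof. by move=> [u0 Ou Ou']; split; rewrite ?invr_neq0 ?invrK. Qed.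

Lemma unit_square_div m n : (0 < m)%N ->
  unit_square_class m -> unit_square_class (m * n) -> unit_square_class n.
Proof.
move=> m0 [x [u [uU xE]]] [y [v [vU yE]]]; exists (y / x), (v / u); split.
  by apply: int_unit_mul => //; exact: int_unit_inv.
have m0' := natK_neq0 K m0; have [u0 _ _] := uU.
by rewrite expr_div_n xE yE natrM; field; rewrite u0.
Qed.

Lemma unit_square_sqr (w : K) n : w ^+ 2 = n%:R -> unit_square_class n.
Proof.
move=> wE; exists w, 1; split; last by rewrite wE mulr1.
by split; rewrite ?oner_eq0 ?invr1 //; exact: OK1.
Qed.

(** The square of d2 v + u w is d2 (d2 v^2 + d1 u^2 + 2 u v w). The product of the
second factor with its conjugate is (d2 v^2 - d1 u^2)^2 = c^2, and for c = 2 that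
factor is divisible by 2, so that its quotient by c is a unit. *)
Lemma unit_square_pell (w : K) c d1 d2 u v : w ^+ 2 = (d1 * d2)%:R ->
  (c == 1)%N || (c == 2)%N -> (d2 * v ^ 2 = d1 * u ^ 2 + c)%N ->
  unit_square_class (c * d2).
Proof.
move=> wE c12 E.
have Ow : OK w by apply: OK_sqrt; rewrite wE; exact: OK_nat.
have EK : d2%:R * v%:R ^+ 2 = d1%:R * u%:R ^+ 2 + c%:R :> K.
  by rewrite -!natrX -!natrM -natrD E.
have unitE (e f : K) : OK e -> OK f -> e * f = 1 -> int_unit e.
  move=> Oe Of ef; have e0 : e != 0.
    by apply: contra_eq_neq ef => ->; rewrite mul0r eq_sym oner_eq0.
  by split=> //; rewrite -[e^-1]mulr1 -ef mulKf.
have Ouvw : OK (u%:R * v%:R * w) by apply: OKM => //; apply: OKM; exact: OK_nat.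
rewrite natrM in wE.
case/orP: c12 => /eqP cE; rewrite cE in EK *.
  pose x := d2%:R * v%:R ^+ 2 + d1%:R * u%:R ^+ 2 : K.
  have Ox : OK x.
    by rewrite /x -!natrX -!natrM -natrD; exact: OK_nat.
  exists (d2%:R * v%:R + u%:R * w), (x + 2%:R * (u%:R * v%:R * w)); split.
    have O2 : OK (2%:R * (u%:R * v%:R * w)) by apply: OKM => //; exact: OK_nat.
    apply: (unitE _ (x - 2%:R * (u%:R * v%:R * w))); [exact: OKD|exact: OKB|].
    transitivity (x ^+ 2 - 4%:R * u%:R ^+ 2 * v%:R ^+ 2 * w ^+ 2); first by ring.
    rewrite wE; transitivity ((d2%:R * v%:R ^+ 2 - d1%:R * u%:R ^+ 2) ^+ 2 : K).
      by rewrite /x; ring.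
    by rewrite EK; ring.
  rewrite mul1n; transitivity (d2%:R ^+ 2 * v%:R ^+ 2 + u%:R ^+ 2 * w ^+ 2
     + 2%:R * d2%:R * (u%:R * v%:R * w)); first by ring.
  by rewrite wE /x; ring.
pose x := 1 + d1%:R * u%:R ^+ 2 : K.
have Ox : OK x.
  by rewrite /x -natrX -natrM; apply: OKD; [exact: OK1|exact: OK_nat].
have x2 : 2%:R * x = d2%:R * v%:R ^+ 2 + d1%:R * u%:R ^+ 2 by rewrite EK /x; ring.
exists (d2%:R * v%:R + u%:R * w), (x + u%:R * v%:R * w); split.
  apply: (unitE _ (x - u%:R * v%:R * w)); [exact: OKD|exact: OKB|].
  transitivity (x ^+ 2 - u%:R ^+ 2 * w ^+ 2 * v%:R ^+ 2); first by ring.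
  rewrite wE; transitivity (x ^+ 2 - d1%:R * u%:R ^+ 2 * (d2%:R * v%:R ^+ 2)); first by ring.
  by rewrite EK /x; ring.
transitivity (d2%:R ^+ 2 * v%:R ^+ 2 + u%:R ^+ 2 * w ^+ 2
     + 2%:R * d2%:R * (u%:R * v%:R * w)); first by ring.
rewrite wE natrM; transitivity (d2%:R * (2%:R * x + 2%:R * (u%:R * v%:R * w))); last by ring.
by rewrite x2; ring.
Qed.
End UnitSquare.

Section Main.
Variables (p q r s : nat).
Hypotheses (p_prime : prime p) (q_prime : prime q)
    (r_prime : prime r) (s_prime : prime s)
    (pqrs_distinct : uniq [:: p; q; r; s])
    (p_mod4 : p = 3 %[mod 4]) (q_mod4 : q = 3 %[mod 4])
    (r_mod4 : r = 3 %[mod 4]) (s_mod4 : s = 3 %[mod 4]).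
Variables (K : fieldExtType rat) (a b : K).
Hypotheses (a_sqrt : a ^+ 2 = p%:R) (b_sqrt : b ^+ 2 = (q * r * s)%:R)
    (K_gen : <<1 & [:: a; b]>>%VS = {:K}%VS).

(** At 2, p, q, r, s the generator of the Ostrowski ideal is the element whose square is
the prime times a unit; at all other primes it is the prime itself. *)
Lemma polya_of_unit_squares :
  [/\ unit_square_class K 2, unit_square_class K q, unit_square_class K r
    & unit_square_class K s] -> is_polya_field K.
Proof.
move=> [S2 Sq Sr Ss] l f pl _.
have Sp := unit_square_sqr a_sqrt.
have /and5P[pqrs qrs rs _ _] := pqrs_distinct.
have ns ps : uniq ps -> all prime ps -> ps != [::] -> nonsquare (\prod_(m <- ps) m)%N.
  exact: nonsquare_prod_primes.
have nsA : nonsquare p.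
  by have := ns [:: p]; rewrite big_cons big_nil muln1; apply; rewrite //= p_prime.
have nsB : nonsquare (q * r * s).
  have := ns [:: q; r; s]; rewrite !big_cons big_nil muln1 mulnA; apply=> //.
    by case/andP: pqrs_distinct.
  by rewrite /= q_prime r_prime s_prime.
have nsAB : nonsquare (p * (q * r * s)).
  have := ns _ pqrs_distinct; rewrite !big_cons big_nil muln1 (mulnA q); apply=> //.
  by rewrite /= p_prime q_prime r_prime s_prime.
have B4 : (q * r * s = 3 %[mod 4])%N.
  by rewrite -modnMm -(modnMm q) q_mod4 r_mod4 s_mod4.
have GP := @galois_involution K p (q * r * s) a b a_sqrt b_sqrt nsA nsB nsAB K_gen.
have memS (alpha u : K) m : int_unit u -> alpha ^+ 2 = l%:R * u -> is_maximal_ideal m ->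
    m l%:R -> m alpha.
  move=> [u0 Ou Ou'] aE mM ml; have [mi _ _] := mM.
  have Oa : ringOfIntegers alpha.
    by apply: OK_sqrt; rewrite aE; apply: OKM => //; exact: OK_nat.
  have : m (alpha * alpha) by rewrite -expr2 aE; apply: (ideal_mulOr mi).
  by case/(maximal_prime mM Oa Oa).
have int_root (alpha u : K) : int_unit u -> alpha ^+ 2 = l%:R * u ->
    ringOfIntegers alpha /\ alpha != 0.
  move=> [u0 Ou Ou'] aE; split.
    by apply: OK_sqrt; rewrite aE; apply: OKM => //; exact: OK_nat.
  apply: contraTneq (mulf_neq0 (natK_neq0 K (prime_gt0 pl)) u0) => al0.
  by rewrite -aE al0 expr0n eqxx.
have [l2|l2] := eqVneq l 2%N.
  rewrite l2 in memS int_root *.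
  have [alpha [u [uU aE]]] := S2.
  have [Oa a0] := int_root _ _ uU aE.
  apply: (@ostrowski_principal K _ 2 f alpha isT GP Oa a0) => //; first by move=> m; exact: memS uU aE.
  move=> J Ji Ja Jh Jz x.
  exact: (ramified2_div a_sqrt b_sqrt nsA nsB nsAB K_gen p_mod4 B4 Ji uU aE Ja Jh Jz).
have co x : prime x -> x != l -> coprime x l.
  by move=> px xl; rewrite prime_coprime // dvdn_prime2.
have co4 : coprime 4 l by rewrite (@coprimeXl 2 2) // co // eq_sym.
have ram k : unit_square_class K l -> (p * (q * r * s) = k * l)%N -> coprime k l ->
    is_principal (ostrowski_ideal l f : set K).
  move=> [alpha [u [uU aE]]] kE kl; have [Oa a0] := int_root _ _ uU aE.
  apply: (@ostrowski_principal K _ l f alpha pl GP Oa a0) => //; first by move=> m; exact: memS uU aE.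
  move=> J Ji Ja Jh Jz x.
  apply: (ramified_div a_sqrt b_sqrt nsA nsB nsAB K_gen (prime_gt0 pl) Ji Jh Jz uU aE kE).
  by rewrite coprimeMl co4.
move: pqrs qrs rs; rewrite !inE !negb_or => /and3P[pq pr ps] /andP[qr qs] rs.
have [lp|lp] := eqVneq p l.
  by rewrite -lp in co ram *; apply: (ram (q * r * s)%N) => //;
    rewrite ?coprimeMl ?co // 1?eq_sym // mulnC.
have [lq|lq] := eqVneq q l.
  by rewrite -lq in co ram *; apply: (ram (p * r * s)%N) => //;
    [lia|rewrite !coprimeMl !co // 1?eq_sym].
have [lr|lr] := eqVneq r l.
  by rewrite -lr in co ram *; apply: (ram (p * q * s)%N) => //;
    [lia|rewrite !coprimeMl !co // 1?eq_sym].
have [ls|ls] := eqVneq s l.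
  by rewrite -ls in co ram *; apply: (ram (p * q * r)%N) => //;
    [lia|rewrite !coprimeMl !co // 1?eq_sym].
have l0 := natK_neq0 K (prime_gt0 pl).
apply: (@ostrowski_principal K _ l f l%:R pl GP (OK_nat K l) l0) => //.
move=> J Ji Ja Jh Jz x.
apply: (unramified_div a_sqrt b_sqrt nsA nsB nsAB K_gen (prime_gt0 pl) Ji Jh Jz).
by rewrite !coprimeMl co4 !co.
Qed.
End Main.

Theorem theorem3 (p q r s : nat)
    (p_prime : prime p) (q_prime : prime q)
    (r_prime : prime r) (s_prime : prime s)
    (pqrs_distinct : uniq [:: p; q; r; s])
    (p_mod4 : p = 3 %[mod 4]) (q_mod4 : q = 3 %[mod 4])
    (r_mod4 : r = 3 %[mod 4]) (s_mod4 : s = 3 %[mod 4])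
    (K : fieldExtType rat) (a b : K)
    (a_sqrt : a ^+ 2 = p%:R) (b_sqrt : b ^+ 2 = (q * r * s)%:R)
    (K_gen : <<1 & [:: a; b]>>%VS = {:K}%VS) :
  ([/\ legendre 2 r <> legendre 2 s,
       legendre q r = 1, legendre q s = 1, legendre p q = 1
     & legendre p r = -1 /\ legendre p s = -1] ->
   is_polya_field K)
  /\
  ([/\ legendre 2 r = legendre 2 s, legendre 2 s <> legendre 2 q,
       legendre q r = legendre r s, legendre r s = legendre s q
     & legendre (p * r)%N s = -1 /\ legendre (p * s)%N r = -1] ->
   is_polya_field K).
Proof.
have polya : symbols1 p q r s || symbols2 p q r s -> is_polya_field K.
  move=> sym.
  apply: (polya_of_unit_squares p_prime q_prime r_prime s_prime pqrs_distinct
    p_mod4 q_mod4 r_mod4 s_mod4 a_sqrt b_sqrt K_gen).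
  apply: (@class_2qrs p q r s) sym => //.
  - by move=> m n m0; apply: unit_square_div.
  - exact: unit_square_sqr a_sqrt.
  - exact: unit_square_sqr b_sqrt.
  move=> c d1 d2 u v d12.
  case: d12 => d12; [apply: (@unit_square_pell K a)|apply: (@unit_square_pell K b)
    |apply: (@unit_square_pell K (a * b))].
  - by rewrite d12.
  - by rewrite d12.
  - by rewrite d12 exprMn a_sqrt b_sqrt -natrM.
have [sym_i sym_ii] := symbols_of_legendre p_prime q_prime r_prime s_prime
  pqrs_distinct q_mod4 r_mod4 s_mod4.
by split=> [/sym_i|/sym_ii] sym; apply: polya; rewrite sym ?orbT.
Qed.
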